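(* The exchange graph of any skew-symmetric cluster algebra (with coefficients in an arbitrary semifield) only depends on its defining matrix. That is, if $\mathcal A(\mathbf x,\mathbf y,B)$ and $\mathcal A(\mathbf x',\mathbf y',B)$ are cluster algebras over semifields $\mathbb P$ and $\mathbb P'$ respectively, with the same skew-symmetric integer matrix $B$ in their initial seeds, then their exchange graphs are isomorphic.
   Context: Cluster algebras with arbitrary coefficients (Fomin–Zelevinsky). Let $(\mathbb{P},\oplus,\cdot)$ be a semifield: an abelian multiplicative group with a commutative, associative addition $\oplus$ over which multiplication distributes. Let $\mathbb{Z}\mathbb{P}$ be the group ring of its multiplicative group, $\mathbb{Q}\mathbb{P}$ the fraction field of $\mathbb{Z}\mathbb{P}$, and $\mathcal{F}$ a field of rational functions in $m$ variables over $\mathbb{Q}\mathbb{P}$. A seed is a triple $(\mathbf{x},\mathbf{y},B)$ where $\mathbf x=(x_1,\dots,x_m)$ is a free generating set of $\mathcal F$ over $\mathbb{Q}\mathbb{P}$ (the cluster), $\mathbf y=(y_1,\dots,y_m)$ is a tuple in $\mathbb{P}$, and $B=(b_{ij})$ is a skew-symmetric integer $m\times m$ matrix. Write $[z]_+=\max(z,0)$. The mutation at $k$ replaces $(\mathbf x,\mathbf y,B)$ by $(\mathbf x',\mathbf y',B')$ with: $b'_{ij}=-b_{ij}$ if $i=k$ or $j=k$ and $b'_{ij}=b_{ij}+\frac{b_{ik}|b_{kj}|+|b_{ik}|b_{kj}}{2}$ otherwise; $y'_k=y_k^{-1}$ and $y'_j=y_jy_k^{[b_{kj}]_+}(y_k\oplus1)^{-b_{kj}}$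 for $j\ne k$; $x'_j=x_j$ for $j\neq k$ and $$x'_k=\frac{y_k\prod_i x_i^{[b_{ik}]_+}+\prod_i x_i^{[-b_{ik}]_+}}{(y_k\oplus1)\,x_k}.$$ Fix an initial seed $(\mathbf x,\mathbf y,B)$; its matrix $B$ is the defining matrix. The seeds of $\mathcal A(\mathbf x,\mathbf y,B)$ are those obtained from the initial seed by iterated mutations, cluster variables are the elements of their clusters, and $\mathcal A(\mathbf x,\mathbf y,B)$ is the $\mathbb{Z}\mathbb{P}$-subalgebra of $\mathcal F$ generated by all cluster variables. The exchange graph of $\mathcal A(\mathbf x,\mathbf y,B)$ is the $m$-regular connected graph whose vertices are the seeds of $\mathcal A(\mathbf x,\mathbf y,B)$, up to simultaneous renumbering of rows, columns and variables, and whose edges connect the seeds related by a single mutation. *)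

(* Defs.v *)
From HB Require Import structures.
From mathcomp Require Import all_boot all_order all_algebra perm.
From mathcomp Require Import generic_quotient fraction.
From mathcomp Require Import finmap.
From mathcomp Require Import monalg.
From mathcomp Require boolp mpoly.

Set Implicit Arguments.
Unset Strict Implicit.
Unset Printing Implicit Defensive.

Import Order.TTheory GRing.Theory Num.Theory.

Local Open Scope ring_scope.
Local Open Scope quotient_scope.

HB.mixin Record Group_isSemifield P of Group P := {
  sfmulC : commutative (@monoid.mul P);
  sfadd : P -> P -> P;
  sfaddA : associative sfadd;
  sfaddC : commutative sfadd;
  sfmulDl : left_distributive (@monoid.mul P) sfadd
}.

#[short(type="semifieldType")]
HB.structure Definition Semifield := {P of Group P & Group_isSemifield P}.

Notation "p ⊕ q" := (sfadd p q) (at level 50, left associativity) : group_scope.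

Section SemifieldTheory.
Variable P : semifieldType.
Implicit Types x y c : P.
Local Open Scope group_scope.

Lemma sfmulDr x y c : c * (x ⊕ y) = (c * x) ⊕ (c * y).
Proof. by rewrite sfmulC sfmulDl !(sfmulC c). Qed.

Lemma sfmulACA (a b c d : P) : (a * b) * (c * d) = (a * c) * (b * d).
Proof. by rewrite -!mulgA; congr (a * _); rewrite !mulgA (sfmulC b). Qed.

Lemma sf_torsion_free x n : (0 < n)%N -> x ^+ n = 1 -> x = 1.
Proof.
case: n => // -[|n] _ xn1; first by [].
pose s := fix s i : P := if i is j.+1 then s j ⊕ x ^+ i else 1.
have sS i : s i.+1 = s i ⊕ x ^+ i.+1 by [].
have sE i : s i.+1 = 1 ⊕ x * s i.
  elim: i => [|i IH]; first by rewrite /s mulg1.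
  by rewrite sS {1}IH [in RHS]sS sfmulDr -expgS sfaddA.
apply: (@mulIg P (s n.+1)); rewrite mul1g.
by rewrite {1}sS sfmulDr -expgS xn1 sfaddC -sE.
Qed.

(* A semifield is torsion free, so any finite set of elements other than 1 can
   be signed by a pointed submonoid. Hence finite subsets have a uniquely
   represented product and the group ring is an integral domain. *)
Definition cone (C : P -> Prop) :=
  [/\ C 1, forall x y, C x -> C y -> C (x * y)
    & forall x, C x -> C x^-1 -> x = 1].

Lemma coneX C x n : cone C -> C x -> C (x ^+ n).
Proof.
by move=> [C1 CM _] Cx; elim: n => // n IH; rewrite expgS; apply: CM.
Qed.

Lemma cone_adjoin C x : cone C -> (forall n, (0 < n)%N -> ~ C (x ^- n)) ->
  exists D, [/\ cone D, forall y, C y -> D y & D x].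
Proof.
move=> [C1 CM CV] hx.
exists (fun z => exists c n, C c /\ z = c * x ^+ n); split; last 2 first.
- by move=> y Cy; exists y, 0%N; rewrite mulg1.
- by exists 1, 1%N; rewrite mul1g.
split; first by exists 1, 0%N; rewrite mulg1.
  move=> _ _ [c [n [Cc ->]]] [d [k [Cd ->]]]; exists (c * d), (n + k)%N.
  split; first exact: CM.
  by rewrite expgnDr sfmulACA.
move=> z [c [n [Cc zE]]] [d [k [Cd zVE]]].
have cdE : c * d = x ^- (n + k).
  apply: (@mulIg P (x ^+ (n + k))); rewrite mulVg expgnDr.
  by rewrite sfmulACA -zE -zVE mulgV.
have nk0 : (n + k = 0)%N.
  by case E: (n + k)%N => [//|l]; case: (hx (n + k)%N); rewrite ?E // -E -cdE; apply: CM.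
have [n0 k0] : (n = 0 /\ k = 0)%N by case: n k nk0 {cdE zE zVE} => [|?] [|?].
by move: zE zVE; rewrite n0 k0 !mulg1 => -> ?; apply: CV => //; subst.
Qed.

Lemma cone_list (L : seq P) :
  exists2 C, cone C & forall x, x \in L -> C x \/ C x^-1.
Proof.
elim: L => [|x L [C Ccone IH]].
  exists (fun x => x = 1) => //; split=> // y z -> ->; exact: mulg1.
have [C1 CM CV] := Ccone.
have fin D : cone D -> (forall y, C y -> D y) -> D x \/ D x^-1 ->
    exists2 C, cone C & forall y, y \in x :: L -> C y \/ C y^-1.
  move=> cD CD Dx; exists D => // y; rewrite inE => /orP[/eqP-> //|/IH].
  by case=> /CD; [left|right].
have [|N1] := boolp.EM (forall n, (0 < n)%N -> ~ C (x ^- n)).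
  by case/(cone_adjoin Ccone) => D [cD CD Dx]; apply: (fin D) => //; left.
have [|N2] := boolp.EM (forall n, (0 < n)%N -> ~ C (x^-1 ^- n)).
  by case/(cone_adjoin Ccone) => D [cD CD Dx]; apply: (fin D) => //; right.
have [n n0 Cn] : exists2 n, (0 < n)%N & C (x ^- n).
  by apply: boolp.contrapT => h; apply: N1 => n n0 Cn; apply: h; exists n.
have [k k0 Ck] : exists2 n, (0 < n)%N & C (x^-1 ^- n).
  by apply: boolp.contrapT => h; apply: N2 => k k0 Ck; apply: h; exists k.
apply: (fin C) => //; left; suff -> : x = 1 by [].
apply: (@sf_torsion_free _ (n * k)); first by rewrite muln_gt0 n0.
rewrite expVgn invgK in Ck.
apply: CV; first by rewrite mulnC expgnA; apply: coneX.
by rewrite expgnA -expVgn; apply: coneX.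
Qed.

Lemma cone_max C (A : seq P) : cone C -> A != [::] ->
    (forall x y, x \in A -> y \in A -> C (x / y) \/ C (x / y)^-1) ->
  exists2 a, a \in A & forall x, x \in A -> C (a / x).
Proof.
move=> [C1 CM _]; elim: A => // a [|b A] IH _ tot.
  by exists a; rewrite ?mem_head // => x; rewrite inE => /eqP->; rewrite mulgV.
have [//|x y xA yA|c cA cmax] := IH.
  by apply: tot; rewrite inE ?xA ?yA orbT.
have caA : c \in [:: a, b & A] by rewrite inE cA orbT.
have [Cac|] := tot a c (mem_head _ _) caA.
  exists a; rewrite ?mem_head // => x; rewrite inE => /orP[/eqP->|/cmax].
    by rewrite mulgV.
  by move=> /(CM _ _ Cac); rewrite mulgA mulgVK.
rewrite invgF => Cca; exists c => //.
by move=> x; rewrite inE => /orP[/eqP->|/cmax].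
Qed.

Lemma unique_product (A B : seq P) : A != [::] -> B != [::] ->
  exists a b, [/\ a \in A, b \in B & forall x y, x \in A -> y \in B ->
    x * y = a * b -> x = a /\ y = b].
Proof.
move=> A0 B0.
have [C cC tot] := cone_list ([seq x / y | x <- A, y <- A] ++
                              [seq x / y | x <- B, y <- B]).
have [|a aA amax] := cone_max cC A0.
  by move=> x y xA yA; apply: tot; rewrite mem_cat (allpairs_f (fun x y => x / y)).
have [|b bB bmax] := cone_max cC B0.
  by move=> x y xA yA; apply: tot; rewrite mem_cat; apply/orP; right; exact: (allpairs_f (fun x y => x / y)).
exists a, b; split=> // x y xA yB xyab; have [_ _ CV] := cC.
have E : a / x = (b / y)^-1.
  rewrite invgF; apply: (@mulIg P x); rewrite mulgVK.
  apply: (@mulIg P b); rewrite -xyab [RHS]sfmulC.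
  by rewrite [RHS]mulgA [b * _]sfmulC mulgVK sfmulC.
have ax1 : a / x = 1 by apply: CV; [exact: amax|rewrite E invgK; exact: bmax].
have := E; rewrite ax1 => /(congr1 (@monoid.inv P)); rewrite invgK invg1 => /esym by1.
by rewrite (divg1_eq ax1) (divg1_eq by1).
Qed.

End SemifieldTheory.

Definition groupring (P : semifieldType) : Type := {malg int[P]}.

Section GroupRing.
Variable P : semifieldType.
Local Notation ZP := (groupring P).
Implicit Types (f g h : ZP) (c d : int) (p q : P).

HB.instance Definition _ := GRing.Zmodule.copy ZP {malg int[P]}.

Definition gr_one : ZP := << 1 *g 1%g >>.

Definition gr_mul f g : ZP :=
  \sum_(p <- msupp f) \sum_(q <- msupp g)
    << mcoeff p f * mcoeff q g *g (p * q)%g >>.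

Lemma gr_mulw (A B : {fset P}) f g :
  (msupp f `<=` A)%fset -> (msupp g `<=` B)%fset ->
  gr_mul f g = \sum_(p <- A) \sum_(q <- B)
    << mcoeff p f * mcoeff q g *g (p * q)%g >>.
Proof.
move=> fA gB; rewrite /gr_mul (big_fset_incl _ fA) /=.
  apply/eq_bigr=> p _; apply/big_fset_incl => // q _ /mcoeff_outdom ->.
  by rewrite mulr0 monalgU0.
move=> p _ /mcoeff_outdom fp.
by rewrite big1 => // q _; rewrite fp mul0r monalgU0.
Qed.

Lemma gr_mulC : commutative gr_mul.
Proof.
move=> f g; rewrite /gr_mul exchange_big; apply: eq_bigr => q _.
by apply: eq_bigr => p _; rewrite mulrC sfmulC.
Qed.

Lemma gr_mulDl : left_distributive gr_mul +%R.
Proof.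
move=> f g h.
rewrite (gr_mulw (msuppD_le _ _) (fsubset_refl _)).
rewrite (gr_mulw (fsubsetUl _ (msupp g)) (fsubset_refl _)).
rewrite (gr_mulw (fsubsetUr (msupp f) _) (fsubset_refl _)).
rewrite -big_split; apply: eq_bigr => p _; rewrite -big_split.
by apply: eq_bigr => q _; rewrite mcoeffD mulrDl monalgUD.
Qed.

Lemma gr_mulDr : right_distributive gr_mul +%R.
Proof. by move=> f g h; rewrite gr_mulC gr_mulDl !(gr_mulC f). Qed.

Lemma gr_mul0 f : gr_mul 0 f = 0.
Proof. by rewrite /gr_mul [msupp _]msupp0 big_seq_fset0. Qed.

Lemma gr_mulUU c d p q :
  gr_mul << c *g p >> << d *g q >> = << c * d *g (p * q)%g >>.
Proof.
by rewrite (gr_mulw msuppU_le msuppU_le) !big_seq_fset1 !mcoeffUU.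
Qed.

Lemma gr_mul_sumr (I : Type) (r : seq I) (E : I -> ZP) f :
  gr_mul f (\sum_(i <- r) E i) = \sum_(i <- r) gr_mul f (E i).
Proof.
apply: (big_morph (gr_mul f)); first by move=> ? ?; exact: gr_mulDr.
by rewrite gr_mulC gr_mul0.
Qed.

Lemma gr_mul_suml (I : Type) (r : seq I) (E : I -> ZP) f :
  gr_mul (\sum_(i <- r) E i) f = \sum_(i <- r) gr_mul (E i) f.
Proof.
by rewrite gr_mulC gr_mul_sumr; apply: eq_bigr => i _; rewrite gr_mulC.
Qed.

Lemma gr_expand f : f = \sum_(p <- msupp f)
  (<< mcoeff p f *g p >> : ZP).
Proof. exact: monalgE. Qed.

Lemma gr_mul1 : left_id gr_one gr_mul.
Proof.
move=> f; rewrite {1}(gr_expand f) gr_mul_sumr [RHS]gr_expand.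
by apply: eq_bigr => p _; rewrite gr_mulUU mul1r mul1g.
Qed.

Lemma gr_mulA : associative gr_mul.
Proof.
move=> f g h; rewrite (gr_expand f) !gr_mul_suml; apply: eq_bigr => p _.
rewrite (gr_expand g) gr_mul_sumr !gr_mul_suml gr_mul_sumr.
apply: eq_bigr => q _.
rewrite (gr_expand h) !gr_mul_sumr; apply: eq_bigr => r _.
by rewrite !gr_mulUU mulrA mulgA.
Qed.

Lemma gr_one_neq0 : gr_one != 0.
Proof. by rewrite monalgU_eq0 oner_eq0. Qed.

HB.instance Definition _ := GRing.Zmodule_isComNzRing.Build ZP
  gr_mulA gr_mulC gr_mul1 gr_mulDl gr_one_neq0.

Lemma gr_integral f g : f * g = 0 -> (f == 0) || (g == 0).
Proof.
have supp0 h : h != 0 -> enum_fset (msupp h) != [::].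
  apply: contra => /eqP s0; apply/eqP; rewrite (gr_expand h).
  by rewrite [X in \sum_(_ <- X) _]s0 big_nil.
move=> fg0; case: eqVneq => //= /supp0 f0; apply: contraT => /supp0 g0.
have [a [b [af bg uniq_ab]]] := unique_product f0 g0.
have := congr1 (mcoeff (a * b)%g) (fg0 : gr_mul f g = 0).
rewrite mcoeff0 /gr_mul raddf_sum /= (big_fsetD1 a) //=.
rewrite raddf_sum /= (big_fsetD1 b) //= mcoeffUU big1_fset ?addr0.
  rewrite big1_fset ?addr0.
    by move/eqP; rewrite mulf_eq0 !mcoeff_eq0 af bg.
  move=> p; rewrite !inE => /andP[pa pf] _; rewrite raddf_sum /= big1_fset //.
  move=> q qg _; rewrite mcoeffU; case: eqP => // /(uniq_ab _ _ pf qg).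
  by case=> pE; rewrite pE eqxx in pa.
move=> q; rewrite !inE => /andP[qb qg] _; rewrite mcoeffU.
case: eqP => // /(uniq_ab _ _ af qg)[_ qE]; by rewrite qE eqxx in qb.
Qed.

(* The unit predicate is classical; [{fraction _}] does not depend on them. *)
Definition gr_unit : {pred ZP} := fun f => boolp.asbool (exists g, g * f = 1).

Definition gr_inv f : ZP :=
  if boolp.pselect (exists g, g * f = 1) is left fU
  then sval (boolp.cid fU) else f.

Lemma gr_mulVr : {in gr_unit, left_inverse 1 gr_inv *%R}.
Proof.
move=> f /boolp.asboolP fU; rewrite /gr_inv; case: boolp.pselect => // fU'.
exact: svalP (boolp.cid fU').
Qed.

Lemma gr_unitP f g : g * f = 1 -> gr_unit f.
Proof. by move=> gf; apply/boolp.asboolP; exists g. Qed.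

Lemma gr_invr_out : {in [predC gr_unit], gr_inv =1 id}.
Proof.
move=> f /negP fU; rewrite /gr_inv; case: boolp.pselect => // fU'.
by case: fU; apply/boolp.asboolP.
Qed.

HB.instance Definition _ := GRing.ComNzRing_hasMulInverse.Build ZP
  gr_mulVr gr_unitP gr_invr_out.

HB.instance Definition _ := GRing.ComUnitRing_isIntegral.Build ZP gr_integral.

End GroupRing.


Notation ratfield P := {fraction (groupring P)}.

Definition gexpz (G : groupType) (g : G) (z : int) : G :=
  match z with Posz n => (g ^+ n)%g | Negz n => (g ^- n.+1)%g end.

Definition pospart (z : int) : int := Num.max z 0.

Record graph := Graph { vertex : Type; adj : vertex -> vertex -> Prop }.

Definition graph_iso (G H : graph) : Prop :=
  exists2 f : vertex G -> vertex H,
    bijective f & forall u v, adj u v <-> adj (f u) (f v).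

(* Triples (cluster, coefficients, exchange matrix); being a seed is the
   predicate [is_seed] below. *)
Record preseed (m : nat) (P : semifieldType) (F : fieldType) := Preseed {
  cluster : {ffun 'I_m -> F};
  coeffs : {ffun 'I_m -> P};
  exmat : 'M[int]_m
}.

Section PreseedChoice.
Variables (m : nat) (P : semifieldType) (F : fieldType).

Definition preseed_tuple (s : preseed m P F) := (cluster s, coeffs s, exmat s).

Definition tuple_preseed t : preseed m P F := Preseed t.1.1 t.1.2 t.2.

Lemma preseed_tupleK : cancel preseed_tuple tuple_preseed.
Proof. by case. Qed.

HB.instance Definition _ :=
  Choice.copy (preseed m P F) (can_type preseed_tupleK).

End PreseedChoice.

Section Seeds.
Variables (m : nat) (P : semifieldType) (F : fieldType).
Variable iota : {rmorphism ratfield P -> F}.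
Local Notation preseed := (preseed m P F).
Implicit Types (s t : preseed) (k : 'I_m) (sigma : 'S_m).

Definition sfemb (p : P) : F := iota (tofrac (<< 1 *g p >> : groupring P)).

(* [F] is an extension of the fraction field of the group ring via [iota];
   injectivity of evaluation at [x] is algebraic independence. *)
Definition free_generating (x : {ffun 'I_m -> F}) : Prop :=
  injective (mpoly.mmap iota x) /\
  (forall f : F, exists p q : mpoly.mpoly m (ratfield P),
     mpoly.mmap iota x q != 0 /\ f = mpoly.mmap iota x p / mpoly.mmap iota x q).

Definition is_seed s : Prop :=
  free_generating (cluster s) /\ (exmat s)^T = - exmat s.

Definition mut_cluster k s : {ffun 'I_m -> F} :=
  let: Preseed x y B := s in
  [ffun j => if j == k then
      (sfemb (y k) * \prod_i x i ^ pospart (B i k)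
         + \prod_i x i ^ pospart (- B i k))
      / (sfemb (y k ⊕ 1)%g * x k)
    else x j].

Definition mut_coeffs k s : {ffun 'I_m -> P} :=
  let: Preseed x y B := s in
  [ffun j => if j == k then (y k)^-1%g
    else (y j * gexpz (y k) (pospart (B k j))
              * gexpz (y k ⊕ 1) (- B k j)%R)%g].

(* The numerator below is always even, so [%/] is exact. *)
Definition mut_exmat k s : 'M[int]_m :=
  let B := exmat s in
  \matrix_(i, j) if (i == k) || (j == k) then - B i j
    else B i j + ((B i k * `|B k j| + `|B i k| * B k j) %/ 2)%Z.

Definition mutation k s : preseed :=
  Preseed (mut_cluster k s) (mut_coeffs k s) (mut_exmat k s).

Definition mutation_reachable s t : Prop :=
  exists ks : seq 'I_m, t = foldl (fun s k => mutation k s) s ks.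

Definition renumber sigma s : preseed :=
  Preseed [ffun i => cluster s (sigma i)] [ffun i => coeffs s (sigma i)]
    (\matrix_(i, j) exmat s (sigma i) (sigma j)).

Definition renumbering s t : bool :=
  [exists sigma : 'S_m, t == renumber sigma s].

Lemma renumber1 s : renumber 1%g s = s.
Proof.
case: s => x y B; congr Preseed; first by apply/ffunP => i; rewrite ffunE perm1.
  by apply/ffunP => i; rewrite ffunE perm1.
by apply/matrixP => i j; rewrite mxE !perm1.
Qed.

Lemma renumberM sigma tau s :
  renumber tau (renumber sigma s) = renumber (tau * sigma)%g s.
Proof.
congr Preseed; first by apply/ffunP => i; rewrite !ffunE permM.
  by apply/ffunP => i; rewrite !ffunE permM.
by apply/matrixP => i j; rewrite !mxE !permM.
Qed.

Lemma renumbering_refl : reflexive renumbering.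
Proof. by move=> s; apply/existsP; exists 1%g; rewrite renumber1. Qed.

Lemma renumbering_sym : symmetric renumbering.
Proof.
suff H s t : renumbering s t -> renumbering t s by move=> s t; apply/idP/idP; exact: H.
case/existsP=> sigma /eqP->; apply/existsP; exists (sigma^-1)%g.
by rewrite renumberM mulVg renumber1.
Qed.

Lemma renumbering_trans : transitive renumbering.
Proof.
move=> t s u /existsP[sigma /eqP->] /existsP[tau /eqP->].
by apply/existsP; exists (tau * sigma)%g; rewrite renumberM.
Qed.

Canonical renumbering_equiv :=
  EquivRel renumbering renumbering_refl renumbering_sym renumbering_trans.

Definition unlabeled_seed := {eq_quot renumbering}.

Definition unlabel s : unlabeled_seed := \pi_unlabeled_seed s.

Definition exchange_graph s0 : graph := {|
  vertex := {u : unlabeled_seed |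
    exists s, mutation_reachable s0 s /\ u = unlabel s};
  adj := fun u v => exists s k,
    sval u = unlabel s /\ sval v = unlabel (mutation k s)
|}.

End Seeds.

(* Main.v *)
From HB Require Import structures.
Require Import Defs.
From mathcomp Require Import all_boot all_order all_algebra perm.
From mathcomp Require Import mpoly.
From mathcomp Require Import generic_quotient fraction finmap monalg.
From mathcomp Require Import ring zify.
From mathcomp Require boolp.

(** Vertices of an exchange graph are words in the mutations, two words giving
    the same vertex when the seeds they lead to agree up to renumbering, and
    adjacency amounts to lengthening a word by one letter ([graph_iso_param],
    [adj_word]). So the claim is that two words which lead to the same seed up
    to a permutation over one semifield do so, with the same permutation, over
    any other. Rerooting the pattern turns such a coincidence into a _period_: a
    word which brings a seed back to itself up to a permutation [sg]
    ([coincidence_transport]).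

    Periods descend along a homomorphism of semifields [phi : P0 -> P]. Cluster
    variables over [P0] and over [P] are given by the same subtraction-free
    expressions in the initial variables, and an identity between such
    expressions is an equality of two lists of monomials up to order, which
    [phi] respects ([corep], [corep_transfer], [descend_period]). It remains to
    lift a period from [P] to some [P0] which maps to both semifields.
    The choice is [P * P'] times tropical functions ([tcover]), with a
    standard seed in the fraction field of the Laurent polynomial ring, and the
    lift is [lift_period].

    To lift, one uses the Laurent phenomenon over [P0] ([laurent_phenomenon]): the
    cluster variable [X_l] at the end of the word is a Laurent polynomial [f] in
    the initial [x], and over [P] it becomes [x_(sg l)]. Numerator and
    denominator of a subtraction-free expression have positive coefficients, so
    that no monomial disappears under [phi]; comparing leading
    exponents for every coordinate, in both directions, all monomials of [f]
    have the exponents of [x_(sg l)] ([lift_monomial]). Hence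
    [X_l = x_(sg l) * h_l] with [h_l] in the group ring of [P0]. The Laurent
    phenomenon read from the other end of the word makes [h_l] invertible, so it
    is plus or minus a group element ([unit_monomial]); positivity gives the
    sign, and evaluating every sum with the addition of [P0] sends all cluster
    variables to 1, whence [h_l = 1] ([lift_cluster]). The coefficients follow
    by applying this to the word conjugated by a mutation and
    comparing exchange relations ([lift_coeff]).

    The Laurent phenomenon is obtained by the upper bounds of Berenstein, Fomin
    and Zelevinsky: the intersection over [k] of the subrings generated by
    [x_k], its mutation, and the other variables with their inverses does not
    change under mutation ([upper_mut]). This reduces to two indices [i], [j]
    ([rank_two], [star_exchange]). When the matrix entry [b_ij] vanishes, the
    reduction needs the exchange binomials at [i] and [j] to be coprime, which
    can fail over a given semifield. It holds over [P0] because of the tropical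
    factor: tropical mutation of coefficients is bijective, so after any word
    some integer-valued homomorphism separates the two coefficients
    ([tcover_indep]), and a grading that separates them gives coprimality
    ([binomial_coprime]). *)

Set Implicit Arguments.
Unset Strict Implicit.
Unset Printing Implicit Defensive.

Import Order.TTheory GRing.Theory Num.Theory.
Local Open Scope ring_scope.

(** * Semifields *)

Definition trop (I : Type) : Type := I -> int.

Section Trop.
Variable I : Type.
Implicit Types a b c : trop I.

Definition trop_mul a b : trop I := fun i => a i + b i.
Definition trop_one : trop I := fun=> 0.
Definition trop_inv a : trop I := fun i => - a i.
Definition trop_add a b : trop I := fun i => Num.min (a i) (b i).

Fact trop_mulA : associative trop_mul.
Proof. by move=> a b c; apply: boolp.funext => i; rewrite /trop_mul addrA. Qed.
Fact trop_mul1 : left_id trop_one trop_mul.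
Proof. by move=> a; apply: boolp.funext => i; rewrite /trop_mul add0r. Qed.
Fact trop_mulr1 : right_id trop_one trop_mul.
Proof. by move=> a; apply: boolp.funext => i; rewrite /trop_mul addr0. Qed.
Fact trop_mulV : left_inverse trop_one trop_inv trop_mul.
Proof. by move=> a; apply: boolp.funext => i; rewrite /trop_mul addNr. Qed.
Fact trop_mulrV : right_inverse trop_one trop_inv trop_mul.
Proof. by move=> a; apply: boolp.funext => i; rewrite /trop_mul addrN. Qed.

(* The functions in [trop I] have an arbitrary domain: equality is classical. *)
HB.instance Definition _ := boolp.gen_eqMixin (trop I).
HB.instance Definition _ := boolp.gen_choiceMixin (trop I).
HB.instance Definition _ := isGroup.Build (trop I)
  trop_mulA trop_mul1 trop_mulr1 trop_mulV trop_mulrV.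

Fact trop_mulC : commutative (@monoid.mul (trop I)).
Proof. by move=> a b; apply: boolp.funext => i; exact: addrC. Qed.
Fact trop_addA : associative trop_add.
Proof. by move=> a b c; apply: boolp.funext => i; rewrite /trop_add minA. Qed.
Fact trop_addC : commutative trop_add.
Proof. by move=> a b; apply: boolp.funext => i; rewrite /trop_add minC. Qed.
Fact trop_mulDl : left_distributive (@monoid.mul (trop I)) trop_add.
Proof.
by move=> a b c; apply: boolp.funext => i; rewrite /trop_add; exact: addr_minl.
Qed.

HB.instance Definition _ := Group_isSemifield.Build (trop I)
  trop_mulC trop_addA trop_addC trop_mulDl.

Lemma tropM a b i : (a * b)%g i = a i + b i. Proof. by []. Qed.
End Trop.

Section Pair.
Variables P Q : semifieldType.
Definition pair_sfadd (a b : P * Q) : P * Q := ((a.1 ⊕ b.1)%g, (a.2 ⊕ b.2)%g).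
Fact pair_mulC : commutative (@monoid.mul (P * Q)%type).
Proof. by move=> a b; congr (_, _); exact: sfmulC. Qed.
Fact pair_addA : associative pair_sfadd.
Proof. by move=> a b c; congr (_, _); exact: sfaddA. Qed.
Fact pair_addC : commutative pair_sfadd.
Proof. by move=> a b; congr (_, _); exact: sfaddC. Qed.
Fact pair_mulDl : left_distributive (@monoid.mul (P * Q)%type) pair_sfadd.
Proof. by move=> a b c; congr (_, _); exact: sfmulDl. Qed.
HB.instance Definition _ := Group_isSemifield.Build (P * Q)%type
  pair_mulC pair_addA pair_addC pair_mulDl.
End Pair.

Section GroupPowers.
Variable P : semifieldType.
Implicit Types (p q : P) (a b : int).
Local Open Scope group_scope.

Lemma gexpz0 p : gexpz p 0%R = 1. Proof. by []. Qed.
Lemma gexpzSr p a : gexpz p (a + 1)%R = gexpz p a * p.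
Proof.
case: a => n; first by rewrite -PoszD addn1 /= expgSr.
case: n => [|n]; first by rewrite /= mulVg.
have -> : (Negz n.+1 + 1 = Negz n)%R by lia.
by rewrite /gexpz (expgS p n.+1) invgM mulgVK.
Qed.

Lemma gexpzD p a b : gexpz p (a + b)%R = gexpz p a * gexpz p b.
Proof.
have dec c : gexpz p (c - 1)%R = gexpz p c * p^-1.
  by rewrite -[in RHS](subrK 1%R c) gexpzSr mulgK.
elim: b => [|n IH|n IH]; first by rewrite addr0 mulg1.
  by rewrite intS (addrC 1%R) addrA !gexpzSr IH mulgA.
by rewrite intS (addrC 1%R) opprD addrA !dec IH mulgA.
Qed.

Lemma gexpzN p a : gexpz p (- a)%R = (gexpz p a)^-1.
Proof. by apply: (@mulIg P (gexpz p a)); rewrite -gexpzD addNr mulVg. Qed.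

Lemma gexpzMl p q a : gexpz (p * q) a = gexpz p a * gexpz q a.
Proof.
elim: a => [|n IH|n IH]; first by rewrite mulg1.
  by rewrite intS (addrC 1%R) !gexpzSr IH sfmulACA.
have dec (r : P) (c : int) : gexpz r (c - 1)%R = gexpz r c * r^-1.
  by rewrite gexpzD.
by rewrite intS (addrC 1%R) opprD !dec IH invgM (sfmulC q^-1) sfmulACA.
Qed.

Lemma gexpzV p a : gexpz p^-1 a = (gexpz p a)^-1.
Proof.
apply: (@mulIg P (gexpz p a)); rewrite -gexpzMl !mulVg.
by case: a => n; rewrite /gexpz expg1n // invg1.
Qed.
End GroupPowers.

Lemma gexpz_trop I (a : trop I) (z : int) i : gexpz a z i = a i * z.
Proof.
elim: z => [|n IH|n IH]; first by rewrite mulr0.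
  by rewrite intS (addrC 1%R) gexpzSr tropM IH mulrDr mulr1.
by rewrite intS (addrC 1%R) opprD gexpzD tropM IH mulrBr mulr1.
Qed.

(** * Group rings and their gradings *)

Section RawGroupRing.
Variable G : semifieldType.
Local Notation ZG := (groupring G).
Implicit Types (f g : ZG) (k l : G) (C : G -> Prop).

(** The products in the group ring unfold to sums over supports, and conversion
    tends to run into them. The facts that depend on this description are proved
    here, before the ring is hidden behind an opaque isomorphism. *)
Definition rmon k : ZG := << 1 *g k >>.

Lemma rmonM k l : rmon (k * l)%g = rmon k * rmon l.
Proof. by rewrite [RHS]gr_mulUU mulr1. Qed.

Lemma rmon_coef k l : mcoeff l (rmon k) = (k == l)%:R.
Proof. by rewrite mcoeffU. Qed.

Lemma rawP f g : (forall k, mcoeff k f = mcoeff k g) -> f = g.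
Proof. by move=> fg; apply/malgP. Qed.

Lemma raw_expand f : f = \sum_(k <- msupp f) rmon k *~ mcoeff k f.
Proof.
rewrite {1}(gr_expand f); apply: eq_bigr => k _.
apply: rawP => l; rewrite raddfMz /= mcoeffU rmon_coef.
by case: (k == l); rewrite ?mulr0n ?mul0rz // intz.
Qed.

Lemma raw_ind (S : ZG -> Prop) f :
  S 0 -> (forall g h, S g -> S h -> S (g - h)) ->
  (forall k, k \in msupp f -> S (rmon k)) -> S f.
Proof.
move=> S0 SB Sf; rewrite (raw_expand f).
have SN g : S g -> S (- g) by move=> Sg; rewrite -sub0r; apply: SB.
have SD g h : S g -> S h -> S (g + h).
  by move=> Sg Sh; rewrite -(opprK h); apply/SB/SN.
have Sn g n : S g -> S (g *+ n) by move=> Sg; elim: n => // n IH; rewrite mulrS; apply: SD.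
rewrite big_seq; apply: (big_ind S) => // k /Sf Sk.
by case: (mcoeff k f) => n; [apply: Sn | apply/SN/Sn].
Qed.

Lemma rmon_mul_coef k f l : mcoeff l (rmon k * f) = mcoeff (k^-1 * l)%g f.
Proof.
apply: (@raw_ind (fun f => mcoeff l (rmon k * f) = mcoeff (k^-1 * l)%g f)).
- by rewrite mulr0 !mcoeff0.
- by move=> g h gE hE; rewrite mulrBr !mcoeffB gE hE.
- move=> i _; rewrite -rmonM !rmon_coef; congr (nat_of_bool _)%:R.
  by apply/eqP/eqP => [<-|->]; rewrite ?mulKg ?mulVKg.
Qed.

(** Finitely many elements of a torsion-free group can be ordered by a cone; the
    product of the largest element of each support is met only once in the
    product of the two supports, hence is not cancelled. *)
Lemma raw_leading_term C f g : cone C ->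
    (forall k l, k \in msupp f -> l \in msupp f -> C (k / l)%g \/ C (k / l)^-1%g) ->
    (forall k l, k \in msupp g -> l \in msupp g -> C (k / l)%g \/ C (k / l)^-1%g) ->
    f != 0 -> g != 0 ->
  exists a b, [/\ a \in msupp f, b \in msupp g, (a * b)%g \in msupp (f * g),
    forall k, k \in msupp f -> C (a / k)%g & forall l, l \in msupp g -> C (b / l)%g].
Proof.
move=> coneC totf totg f0 g0.
have supp0 (h : ZG) : h != 0 -> enum_fset (msupp h) != [::].
  apply: contra => /eqP s0; apply/eqP; rewrite (gr_expand h).
  by rewrite [X in \sum_(_ <- X) _]s0 big_nil.
have [a af amax] := cone_max coneC (supp0 _ f0) totf.
have [b bg bmax] := cone_max coneC (supp0 _ g0) totg.
exists a, b; split=> //.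
have uniq_ab x y : x \in msupp f -> y \in msupp g -> (x * y = a * b)%g -> x = a /\ y = b.
  move=> xf yg xyab; have [_ _ CV] := coneC.
  have E : (a / x = (b / y)^-1)%g.
    rewrite invgF; apply: (@mulIg G x); rewrite mulgVK.
    apply: (@mulIg G b); rewrite -xyab [RHS]sfmulC.
    by rewrite [RHS]mulgA [(b * _)%g]sfmulC mulgVK sfmulC.
  have ax1 : (a / x = 1)%g by apply: CV; [exact: amax | rewrite E invgK; exact: bmax].
  by move/divg1_eq: ax1 xyab => <- /mulgI.
rewrite -mcoeff_neq0 -[f * g]/(gr_mul f g) /gr_mul raddf_sum /= (big_fsetD1 a) //=.
rewrite raddf_sum /= (big_fsetD1 b) //= mcoeffUU big1_fset ?addr0.
  by rewrite big1_fset ?addr0 ?mulf_neq0 ?mcoeff_neq0 // => p;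
    rewrite !inE => /andP[pa pf] _; rewrite raddf_sum /= big1_fset // => q qg _;
    rewrite mcoeffU; case: eqP => // /(uniq_ab _ _ pf qg) [pE]; rewrite pE eqxx in pa.
move=> q; rewrite !inE => /andP[qb qg] _; rewrite mcoeffU.
case: eqP => // /(uniq_ab _ _ af qg)[_ qE]; by rewrite qE eqxx in qb.
Qed.

End RawGroupRing.

(** An isomorphic copy of the group ring known only through its ring structure:
    since the proof is opaque, comparing two products of the copy never unfolds
    their definition. *)
Lemma group_algebra_seal (G : semifieldType) :
  { A : idomainType & { seal : {rmorphism groupring G -> A} &
    { unseal : {rmorphism A -> groupring G} | cancel seal unseal /\ cancel unseal seal } } }.
Proof. by exists (groupring G), idfun, idfun. Qed.

Definition zring (G : semifieldType) : idomainType := projT1 (group_algebra_seal G).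

Section GroupRingTheory.
Variable G : semifieldType.
Local Notation ZG := (zring G).
Implicit Types (f g : ZG) (k l : G) (C : G -> Prop).

Let seal : {rmorphism groupring G -> ZG} := projT1 (projT2 (group_algebra_seal G)).
Let unseal : {rmorphism ZG -> groupring G} :=
  sval (projT2 (projT2 (group_algebra_seal G))).
Let sealK : cancel seal unseal.
Proof. exact: (proj1 (svalP (projT2 (projT2 (group_algebra_seal G))))). Qed.
Let unsealK : cancel unseal seal.
Proof. exact: (proj2 (svalP (projT2 (projT2 (group_algebra_seal G))))). Qed.

Definition gmon k : ZG := seal (rmon k).
Definition zcoef k f : int := mcoeff k (unseal f).
Definition zsupp f : {fset G} := msupp (unseal f).

Lemma zcoef0 k : zcoef k 0 = 0. Proof. by rewrite /zcoef rmorph0 mcoeff0. Qed.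
Lemma zcoefB k f g : zcoef k (f - g) = zcoef k f - zcoef k g.
Proof. by rewrite /zcoef rmorphB mcoeffB. Qed.
HB.instance Definition _ k := GRing.isZmodMorphism.Build ZG int (zcoef k)
  (zcoefB k).
Lemma zcoefN k f : zcoef k (- f) = - zcoef k f. Proof. exact: raddfN. Qed.
Lemma zcoefMz k f (z : int) : zcoef k (f *~ z) = zcoef k f *~ z.
Proof. exact: raddfMz. Qed.
Lemma zcoefD k f g : zcoef k (f + g) = zcoef k f + zcoef k g.
Proof. by rewrite /zcoef rmorphD mcoeffD. Qed.
Lemma zcoef_neq0 k f : (zcoef k f != 0) = (k \in zsupp f).
Proof. exact: mcoeff_neq0. Qed.
Lemma zcoef_eq0 k f : (zcoef k f == 0) = (k \notin zsupp f).
Proof. exact: mcoeff_eq0. Qed.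
Lemma zcoef_outdom k f : k \notin zsupp f -> zcoef k f = 0.
Proof. exact: mcoeff_outdom. Qed.

Lemma zcoef_sum (I : Type) (r : seq I) (F : I -> ZG) k :
  zcoef k (\sum_(i <- r) F i) = \sum_(i <- r) zcoef k (F i).
Proof. exact: (big_morph (zcoef k) (zcoefD k) (zcoef0 k)). Qed.

Lemma gmon1 : gmon 1%g = 1. Proof. exact: rmorph1. Qed.

Lemma gmonM k l : gmon (k * l)%g = gmon k * gmon l.
Proof. by rewrite /gmon rmonM rmorphM. Qed.

Lemma gmon_coef k l : zcoef l (gmon k) = (k == l)%:R.
Proof. by rewrite /zcoef /gmon sealK rmon_coef. Qed.

Lemma gmon_neq0 k : gmon k != 0.
Proof.
by apply/eqP => /(congr1 (zcoef k)); rewrite gmon_coef zcoef0 eqxx.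
Qed.

Lemma gmon_inj : injective gmon.
Proof.
move=> k l /(congr1 (zcoef l)); rewrite !gmon_coef eqxx.
by case: eqP => // _ /eqP; rewrite eq_sym oner_eq0.
Qed.

Lemma gmonD_neq0 k l : gmon k + gmon l != 0.
Proof.
apply/eqP => /(congr1 (zcoef k)); rewrite zcoefD zcoef0 !gmon_coef eqxx.
by case: (l == k).
Qed.

Lemma groupringP f g : (forall k, zcoef k f = zcoef k g) -> f = g.
Proof. by move=> fg; rewrite -(unsealK f) -(unsealK g); apply: (congr1 seal); apply: rawP. Qed.

(** Used as an induction principle: a property stable under differences need
    only be checked on group elements. *)
Lemma groupring_ind (S : ZG -> Prop) f :
  S 0 -> (forall g h, S g -> S h -> S (g - h)) ->
  (forall k, k \in zsupp f -> S (gmon k)) -> S f.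
Proof.
move=> S0 SB Sf; rewrite -(unsealK f); apply: (@raw_ind _ (fun u => S (seal u)) (unseal f)).
- by rewrite rmorph0.
- by move=> ? ? ? ?; rewrite rmorphB; apply: SB.
- exact: Sf.
Qed.

Lemma gmon_mul_coef k f l : zcoef l (gmon k * f) = zcoef (k^-1 * l)%g f.
Proof. by rewrite /zcoef /gmon rmorphM sealK rmon_mul_coef. Qed.

Lemma leading_term C f g : cone C ->
    (forall k l, k \in zsupp f -> l \in zsupp f -> C (k / l)%g \/ C (k / l)^-1%g) ->
    (forall k l, k \in zsupp g -> l \in zsupp g -> C (k / l)%g \/ C (k / l)^-1%g) ->
    f != 0 -> g != 0 ->
  exists a b, [/\ a \in zsupp f, b \in zsupp g, (a * b)%g \in zsupp (f * g),
    forall k, k \in zsupp f -> C (a / k)%g & forall l, l \in zsupp g -> C (b / l)%g].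
Proof.
move=> coneC totf totg f0 g0; rewrite /zsupp rmorphM; apply: raw_leading_term => //.
  by apply: contraNneq f0 => f0; rewrite -(unsealK f) f0 rmorph0.
by apply: contraNneq g0 => g0; rewrite -(unsealK g) g0 rmorph0.
Qed.

Section Extension.
Variables (K : comNzRingType) (h : G -> K).

(** The additive extension to the group ring of a map defined on the group. *)
Definition ext f : K := \sum_(k <- zsupp f) (zcoef k f)%:~R * h k.

Lemma extE f : ext f = monalg.mmap intr h (unseal f). Proof. by []. Qed.

Fact ext_is_zmod_morphism : zmod_morphism ext.
Proof. by move=> f g; rewrite !extE rmorphB mmapB. Qed.

HB.instance Definition _ := GRing.isZmodMorphism.Build ZG K ext
  ext_is_zmod_morphism.

Lemma extB f g : ext (f - g) = ext f - ext g. Proof. exact: raddfB. Qed.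
Lemma extD f g : ext (f + g) = ext f + ext g. Proof. exact: raddfD. Qed.
Lemma ext0 : ext 0 = 0. Proof. exact: raddf0. Qed.

Lemma ext_gmon k : ext (gmon k) = h k.
Proof. by rewrite extE /gmon sealK mmapU mul1r. Qed.

Hypothesis (h1 : h 1%g = 1) (hM : {morph h : k l / (k * l)%g >-> k * l}).

Lemma extM f g : ext (f * g) = ext f * ext g.
Proof.
apply: (@groupring_ind (fun f => ext (f * g) = ext f * ext g)).
- by rewrite mul0r ext0 mul0r.
- by move=> f1 f2 E1 E2; rewrite mulrBl !extB mulrBl E1 E2.
move=> k _; apply: (@groupring_ind (fun g => ext (gmon k * g) = ext (gmon k) * ext g)).
- by rewrite mulr0 ext0 mulr0.
- by move=> f1 f2 E1 E2; rewrite mulrBr !extB mulrBr E1 E2.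
by move=> l _; rewrite -gmonM !ext_gmon hM.
Qed.

Lemma ext1 : ext 1 = 1. Proof. by rewrite -gmon1 ext_gmon. Qed.

Lemma extX f n : ext (f ^+ n) = ext f ^+ n.
Proof. by elim: n => [|n IH]; rewrite ?expr0 ?ext1 // !exprS extM IH. Qed.

End Extension.

Section Grading.
Variable w : G -> int.
Hypothesis wM : forall k l, w (k * l)%g = w k + w l.

Lemma grade1 : w 1%g = 0.
Proof. by have := wM 1%g 1%g; rewrite mulg1; lia. Qed.

Lemma gradeV k : w k^-1%g = - w k.
Proof. by apply/eqP; rewrite -addr_eq0 -wM mulVg grade1. Qed.

Lemma gradeX k n : w (k ^+ n)%g = w k *+ n.
Proof. by elim: n => [|n IH]; rewrite ?grade1 // expgS wM IH mulrS. Qed.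

(** The homogeneous component of degree [n] for the grading by [w]. *)
Definition part (n : int) : ZG -> ZG :=
  ext (fun k => if w k == n then gmon k else 0).

HB.instance Definition _ n := GRing.Additive.on (part n).

Lemma partB n f g : part n (f - g) = part n f - part n g.
Proof. exact: raddfB. Qed.
Lemma partD n f g : part n (f + g) = part n f + part n g.
Proof. exact: raddfD. Qed.
Lemma part0 n : part n 0 = 0. Proof. exact: raddf0. Qed.

Lemma part_gmon n k : part n (gmon k) = if w k == n then gmon k else 0.
Proof. exact: ext_gmon. Qed.

Lemma part_coef n f k : zcoef k (part n f) = if w k == n then zcoef k f else 0.
Proof.
apply: (@groupring_ind (fun f =>
  zcoef k (part n f) = if w k == n then zcoef k f else 0)).
- by rewrite part0 zcoef0 if_same.
- by move=> g h gE hE; rewrite partB !zcoefB gE hE; case: ifP; rewrite ?subr0.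
move=> l _; rewrite part_gmon; case: ifP => wl; rewrite ?gmon_coef ?zcoef0.
  case: (l =P k) => [<-|_]; first by rewrite wl.
  by case: ifP.
by case: (l =P k) => [<-|_]; [rewrite wl | case: ifP].
Qed.

Lemma part_supp n f k : k \in zsupp (part n f) -> w k = n /\ k \in zsupp f.
Proof.
by rewrite -!zcoef_neq0 part_coef; case: ifP => [/eqP|_]; rewrite ?eqxx.
Qed.

Lemma part_homog n f : (forall k, k \in zsupp f -> w k = n) -> part n f = f.
Proof.
move=> fn; apply: groupringP => k; rewrite part_coef; case: ifPn => // wk.
apply/esym/eqP; rewrite zcoef_eq0; apply: contra wk => kf; exact/eqP/fn.
Qed.

Lemma part_id n f : part n (part n f) = part n f.
Proof. by apply: part_homog => k /part_supp []. Qed.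

Lemma part_gmonM d n k f : w k = d -> part (d + n) (gmon k * f) = gmon k * part n f.
Proof.
move=> wk; apply: groupringP => l.
rewrite part_coef !gmon_mul_coef part_coef wM gradeV wk.
by have -> : (w l == d + n) = (- d + w l == n) by apply/eqP/eqP; lia.
Qed.

Lemma part_mulh d n f g : (forall k, k \in zsupp f -> w k = d) ->
  part (d + n) (f * g) = f * part n g.
Proof.
move=> fd; apply: (@groupring_ind (fun f => part (d + n) (f * g) = f * part n g)).
- by rewrite !mul0r part0.
- by move=> f1 f2 E1 E2; rewrite !mulrBl partB E1 E2.
- by move=> k /fd; exact: part_gmonM.
Qed.

Lemma part_mulX n (r f : ZG) (l : nat) : (forall k, k \in zsupp r -> w k = 0) ->
  part n (r ^+ l * f) = r ^+ l * part n f.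
Proof.
move=> r0; elim: l => [|l IH]; first by rewrite !mul1r.
by rewrite exprS -!mulrA -[n in LHS]add0r (part_mulh _ _ r0) IH.
Qed.

Lemma part_sum f : f = \sum_(n <- undup [seq w k | k <- zsupp f]) part n f.
Proof.
apply: groupringP => k; rewrite zcoef_sum.
under eq_bigr do rewrite part_coef.
have [kf|kf] := boolP (k \in zsupp f).
  rewrite (bigD1_seq (w k)) ?undup_uniq ?mem_undup ?map_f //= eqxx big1 ?addr0 //.
  by move=> n; rewrite eq_sym => /negPf->.
by rewrite (eqP (_ : zcoef k f == 0)) ?zcoef_eq0 // big1 // => n _; rewrite if_same.
Qed.

Lemma part_ind (S : ZG -> Prop) f :
  S 0 -> (forall g h, S g -> S h -> S (g + h)) ->
  (forall n, S (part n f)) -> S f.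
Proof. by move=> S0 SD Sp; rewrite (part_sum f); apply: (big_ind S). Qed.

Lemma supp_bound f : exists N : nat, forall k, k \in zsupp f -> - N%:Z < w k < N%:Z.
Proof.
exists (\max_(k <- zsupp f) `|w k|%N).+1 => k kf.
suff : (`|w k| <= \max_(k <- zsupp f) `|w k|)%N by lia.
by apply: (leq_bigmax_seq k).
Qed.
End Grading.

Lemma part_comm (w w' : G -> int) n n' f :
  part w n (part w' n' f) = part w' n' (part w n f).
Proof.
apply: groupringP => k; rewrite !part_coef.
by case: (w k == n); case: (w' k == n').
Qed.

Lemma bipart_id (w w' : G -> int) n n' f :
  part w n (part w' n' (part w n (part w' n' f))) = part w n (part w' n' f).
Proof. by rewrite (part_comm w') !part_id. Qed.

(** Multiplication by elements of bidegree zero commutes with taking a bihomogeneous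
    component; [q] and [p] are the exchange binomials of two unlinked indices. *)
Lemma bipart_mulX (w w' : G -> int) n n' (r r' : nat) (p q f : ZG) :
  (forall k l, w (k * l)%g = w k + w l) -> (forall k l, w' (k * l)%g = w' k + w' l) ->
  (forall k, k \in zsupp q -> w k = 0) -> (forall k, k \in zsupp q -> w' k = 0) ->
  (forall k, k \in zsupp p -> w k = 0) -> (forall k, k \in zsupp p -> w' k = 0) ->
  part w n (part w' n' (q ^+ r * (p ^+ r' * f))) =
  q ^+ r * (p ^+ r' * part w n (part w' n' f)).
Proof. by move=> wM w'M qw qw' pw pw'; rewrite !(part_mulX w'M, part_mulX wM). Qed.

End GroupRingTheory.

(** * Divisibility in group rings *)

Section Divisibility.
Variable G : semifieldType.
Local Notation ZG := (zring G).
Implicit Types (f g : ZG) (k l : G) (C : G -> Prop).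

Lemma cone_inv C : cone C -> cone (fun k => C k^-1%g).
Proof.
move=> [C1 CM CV]; split; first by rewrite invg1.
  by move=> k l Ck Cl; rewrite invgM; apply: CM.
by move=> k Ck; rewrite invgK => Ck'; apply: CV.
Qed.

(** A factor of a monomial has equal top and bottom monomials, for any order. *)
Lemma unit_supp f g c : f * g = gmon c -> exists a, forall k, k \in zsupp f -> k = a.
Proof.
move=> fg; have [f0 g0] : f != 0 /\ g != 0.
  by apply/andP; rewrite -negb_or -mulf_eq0 fg gmon_neq0.
have [C coneC tot] := cone_list ([seq (x / y)%g | x <- zsupp f, y <- zsupp f] ++
                                 [seq (x / y)%g | x <- zsupp g, y <- zsupp g]).
have totf k l : k \in zsupp f -> l \in zsupp f -> C (k / l)%g \/ C (k / l)^-1%g.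
  by move=> kf lf; apply: tot; rewrite mem_cat (allpairs_f (fun x y => x / y)%g).
have totg k l : k \in zsupp g -> l \in zsupp g -> C (k / l)%g \/ C (k / l)^-1%g.
  by move=> kf lf; apply: tot; rewrite mem_cat; apply/orP; right;
    exact: (allpairs_f (fun x y => x / y)%g).
have [a [b [af bg abc amax bmax]]] := leading_term coneC totf totg f0 g0.
have [||a' [b' [af' bg' abc' amin bmin]]] := leading_term (cone_inv coneC) _ _ f0 g0.
- by move=> k l kf lf; rewrite invgK; case: (totf k l kf lf); [right | left].
- by move=> k l kf lf; rewrite invgK; case: (totg k l kf lf); [right | left].
have memc k : k \in zsupp (f * g) -> k = c.
  by rewrite fg -zcoef_neq0 gmon_coef; case: (c =P k) => [-> //|_]; rewrite eqxx.
have [C1 CM CV] := coneC.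
(* The top monomials of both factors give the only monomial [c] of the product,
   and so do the bottom ones. *)
have aa' : a = a'.
  apply: divg1_eq; apply: CV; first exact: amax.
  have -> : ((a / a')^-1 = b / b')%g.
    apply: (@mulIg G (a / a')%g); rewrite mulVg.
    have := memc _ abc; rewrite -(memc _ abc') => E.
    rewrite [RHS]sfmulC sfmulACA E -[X in (_ * X)%g](_ : (a' * b')^-1 = _)%g ?mulgV //.
    by rewrite invgM sfmulC.
  exact: bmax.
exists a => k kf; apply/esym/divg1_eq; apply: CV; first exact: amax.
by have := amin k kf; rewrite aa'.
Qed.

Section Weight.
Variable w : G -> int.
Hypothesis wM : forall k l, w (k * l)%g = w k + w l.

(** Refining the weight by an order that makes leading terms unique shows
    that the top weights of two factors add up, attained by a monomial of the
    product that does not cancel. *)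
Lemma top_weight f g : f != 0 -> g != 0 ->
  exists a b, [/\ a \in zsupp f, b \in zsupp g, (a * b)%g \in zsupp (f * g),
    forall k, k \in zsupp f -> w k <= w a & forall l, l \in zsupp g -> w l <= w b].
Proof.
move=> f0 g0.
have [C [C1 CM CV] tot] := cone_list ([seq (x / y)%g | x <- zsupp f, y <- zsupp f] ++
                                 [seq (x / y)%g | x <- zsupp g, y <- zsupp g]).
(* The lexicographic order by weight first, then by the cone [C]. *)
pose D k := (0 < w k) \/ (w k = 0 /\ C k).
have Dtot k : C k \/ C k^-1%g -> D k \/ D k^-1%g.
  rewrite /D (gradeV wM) oppr_gt0 => Ck; case: (ltrgtP (w k) 0) => wk; [by right; left|by left; left|].
  by case: Ck => Ck; [left | right]; right; rewrite ?wk ?oppr0.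
have coneD : cone D.
  split; first by right; rewrite (grade1 wM).
    move=> k l; rewrite /D wM => -[k0|[k0 Ck]] [l0|[l0 Cl]]; [left; lia|left; lia|left; lia|].
    by right; rewrite k0 l0; split=> //; apply: CM.
  move=> k; rewrite /D (gradeV wM) => -[k0|[k0 Ck]] [l0|[l0 Cl]]; try lia.
  exact: CV.
have [||a [b [af bg ab amax bmax]]] := leading_term coneD _ _ f0 g0.
- move=> k l kf lf; apply/Dtot/tot; by rewrite mem_cat (allpairs_f (fun x y => x / y)%g).
- by move=> k l kf lf; apply/Dtot/tot; rewrite mem_cat; apply/orP; right;
    exact: (allpairs_f (fun x y => x / y)%g).
have Dw k l : D (k / l)%g -> w l <= w k.
  by rewrite /D wM (gradeV wM) subr_gt0; case=> [/ltW //|[/eqP]]; rewrite subr_eq0 => /eqP->.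
exists a, b; split=> // k; [by move/amax/Dw | by move/bmax/Dw].
Qed.

(** The constant term [v] of the binomial is invertible, so that a polynomial
    multiple of the binomial has a polynomial quotient. *)
Lemma nonneg_divisor u v f : w v = 0 -> 0 < w u ->
  (forall k, k \in zsupp ((gmon u + gmon v) * f) -> 0 <= w k) ->
  forall k, k \in zsupp f -> 0 <= w k.
Proof.
move=> wv wu pf0.
(* In negative weight, the coefficients of [f] are tied to those of lower
   weight, and these vanish eventually. *)
have step k : w k < 0 -> zcoef k f = - zcoef (v / u * k)%g f.
  move=> wk; have : zcoef (v * k)%g ((gmon u + gmon v) * f) = 0.
    apply/eqP; rewrite zcoef_eq0; apply/negP => /pf0; rewrite wM wv; lia.
  rewrite mulrDl zcoefD !gmon_mul_coef mulKg mulgA (sfmulC u^-1%g).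
  by move/eqP; rewrite addrC addr_eq0 => /eqP.
have [N bdN] := supp_bound w f.
have down n : forall k, w k < 0 -> w k < n%:Z - N%:Z -> zcoef k f = 0.
  elim: n => [|n IH] k wk wkn.
    by apply/eqP; rewrite zcoef_eq0; apply/negP => /bdN; lia.
  by rewrite step // IH ?oppr0 // !wM (gradeV wM) wv; lia.
move=> k kf; rewrite leNgt; apply/negP => wk.
by move: kf; rewrite -zcoef_neq0 (down N k) ?subrr // eqxx.
Qed.

(** The binomial [a + b] is homogeneous, so it divides an element when it
    divides its homogeneous parts; the equation expresses the part of [f] of
    weight [n] through [g] and a part of [f] of smaller weight. *)
Lemma binomial_coprime_lt a b c d f g : w a = w b -> w c < w d ->
  (gmon c + gmon d) * f = (gmon a + gmon b) * g ->
  exists h, f = (gmon a + gmon b) * h.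
Proof.
move=> wab wcd E; set p := gmon a + gmon b in E *.
have ph k : k \in zsupp p -> w k = w a.
  rewrite -zcoef_neq0 zcoefD !gmon_coef.
  by case: (a =P k) => [<- //|_]; case: (b =P k) => [<- //|_]; rewrite addr0 eqxx.
have step n : part w n f = p * (gmon c^-1%g * part w (w c + n - w a) g)
              - gmon (c^-1 * d)%g * part w (n - (w d - w c)) f.
  have Eg : part w (w c + n) (p * g) = p * part w (w c + n - w a) g.
    by rewrite -(part_mulh wM _ _ ph); congr (part w _ _); lia.
  have := congr1 (part w (w c + n)) E.
  rewrite Eg mulrDl partD (part_gmonM wM) //.
  have -> : w c + n = w d + (n - (w d - w c)) by lia.
  rewrite (part_gmonM wM) // => /(congr1 ( *%R (gmon c^-1%g))).
  rewrite mulrDr !mulrA -!gmonM mulVg gmon1 mul1r => /(canRL (addrK _)) ->.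
  by ring.
(* [step] trades the weight [n] for a smaller one, so induct from below the
   support. *)
have [N bdN] := supp_bound w f.
have div n : forall k : int, k < n%:Z - N%:Z -> exists h, part w k f = p * h.
  elim: n => [|n IH] k kn.
    exists 0; rewrite mulr0; apply: groupringP => l; rewrite part_coef zcoef0.
    case: eqP => // wl; apply/eqP; rewrite zcoef_eq0; apply/negP => /bdN; lia.
  have [|h hE] := IH (k - (w d - w c)); first lia.
  exists (gmon c^-1%g * part w (w c + k - w a) g - gmon (c^-1 * d)%g * h).
  by rewrite step hE; ring.
apply: (@part_ind _ w (fun f => exists h, f = p * h)).
- by exists 0; rewrite mulr0.
- by move=> ? ? [h ->] [h' ->]; exists (h + h'); rewrite mulrDr.
- by move=> k; apply: (div (absz (k + N%:Z + 1)%R)); lia.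
Qed.
End Weight.

(** Two binomials are coprime as soon as some grading makes one of them
    homogeneous and not the other one. *)
Lemma binomial_coprime (w : G -> int) a b c d f g :
  (forall k l, w (k * l)%g = w k + w l) -> w a = w b -> w c <> w d ->
  (gmon c + gmon d) * f = (gmon a + gmon b) * g ->
  exists h, f = (gmon a + gmon b) * h.
Proof.
move=> wM wab wcd E; case: (ltrgtP (w c) (w d)) => // wcd'.
  exact: (binomial_coprime_lt wM wab wcd' E).
by rewrite (addrC (gmon c)) in E; apply: (binomial_coprime_lt wM wab wcd' E).
Qed.

Lemma coprimeX (p q : ZG) : p != 0 ->
  (forall f g, q * f = p * g -> exists h, f = p * h) ->
  forall (n k : nat) f g, p ^+ n * f = q ^+ k * g -> exists h, g = p ^+ n * h.
Proof.
move=> p0 cop.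
have one (k : nat) : forall f g, q ^+ k * g = p * f -> exists h, g = p * h.
  elim: k => [|k IH] f g; first by rewrite mul1r => ->; exists f.
  by rewrite exprS -mulrA => /cop [h /IH].
elim=> [|n IH] k f g; first by exists g; rewrite mul1r.
rewrite exprS -mulrA => E; have [h hE] := one k _ _ (esym E).
move: E; rewrite hE (mulrCA (q ^+ k)) => /(mulfI p0) /IH [h' ->].
by exists h'; rewrite mulrA.
Qed.
End Divisibility.

(** * Laurent polynomials and rank two *)

Section GeneratedSubring.
Variable K : comNzRingType.
Implicit Types S : K -> Prop.

Inductive gen S : K -> Prop :=
| gen_in a of S a : gen S a
| gen1 : gen S 1
| genB a b of gen S a & gen S b : gen S (a - b)
| genM a b of gen S a & gen S b : gen S (a * b).

Lemma gen0 S : gen S 0.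
Proof. by rewrite -(subrr 1); apply: genB; exact: gen1. Qed.

Lemma genN S a : gen S a -> gen S (- a).
Proof. by move=> Sa; rewrite -sub0r; apply: genB => //; exact: gen0. Qed.

Lemma genD S a b : gen S a -> gen S b -> gen S (a + b).
Proof. by move=> Sa Sb; rewrite -(opprK b); apply/genB/genN. Qed.

Lemma genX S a n : gen S a -> gen S (a ^+ n).
Proof. by move=> Sa; elim: n => [|n IH]; [exact: gen1 | rewrite exprS; exact: genM]. Qed.

Lemma gen_sub S S' a : (forall b, S b -> gen S' b) -> gen S a -> gen S' a.
Proof.
move=> SS'; elim=> {a} [a /SS' //||a b _ Sa _ Sb|a b _ Sa _ Sb].
- exact: gen1.
- exact: genB.
- exact: genM.
Qed.
End GeneratedSubring.

(** Laurent monomials in [m] variables with coefficients in [P]. They form a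
    semifield too, whose group ring is the ring of Laurent polynomials over the
    group ring of [P]. *)
Definition gam (m : nat) (P : semifieldType) : semifieldType :=
  [the semifieldType of (P * trop 'I_m)%type].

Section Frame.
Variables (m : nat) (P : semifieldType) (K : fieldType) (emb : P -> K).
Local Notation G := (gam m P).
Implicit Types (x : {ffun 'I_m -> K}) (g h : G) (i j k : 'I_m).

Definition multiplicative_map := emb 1%g = 1 /\ {morph emb : p q / (p * q)%g >-> p * q}.

Definition mon x g : K := emb g.1 * \prod_i x i ^ g.2 i.

Definition ev x : zring G -> K := ext (mon x).

Definition alg_free x := injective (ev x).

Definition var i : G := (1%g, fun j => (j == i)%:Z).
Definition cst (p : P) : G := (p, 1%g).
Definition expo i g : int := g.2 i.

Lemma expoM i g h : expo i (g * h)%g = expo i g + expo i h. Proof. by []. Qed.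
Lemma expo_var i j : expo i (var j) = (i == j)%:Z. Proof. by []. Qed.
Lemma expo_cst i p : expo i (cst p) = 0. Proof. by []. Qed.

Lemma cstM p q : cst (p * q)%g = (cst p * cst q)%g.
Proof. by congr (_, _); rewrite mulg1. Qed.

Hypothesis embP : multiplicative_map.

Lemma emb_neq0 p : emb p != 0.
Proof.
apply/negP => /eqP p0; have := oner_neq0 K.
by rewrite -embP.1 -(mulgV p) embP.2 p0 mul0r eqxx.
Qed.

Lemma embV p : emb p^-1%g = (emb p)^-1.
Proof. by apply: (mulfI (emb_neq0 p)); rewrite -embP.2 mulgV embP.1 divff ?emb_neq0. Qed.

Lemma mon_var x i : mon x (var i) = x i.
Proof.
rewrite /mon embP.1 mul1r (bigD1 i) //= eqxx expr1z big1 ?mulr1 // => j /negPf->.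
by rewrite expr0z.
Qed.

Lemma mon_cst x p : mon x (cst p) = emb p.
Proof. by rewrite /mon big1 ?mulr1 // => i _; rewrite expr0z. Qed.

Lemma mon1 x : mon x 1%g = 1.
Proof. by rewrite -[1%g]/(cst 1%g) mon_cst embP.1. Qed.

Section Free.
Variable x : {ffun 'I_m -> K}.
Hypothesis xfree : alg_free x.

Lemma mon_neq0 g : mon x g != 0.
Proof.
rewrite -(ext_gmon (mon x)) -(ext0 (mon x)).
by apply/negP => /eqP /xfree /eqP; rewrite (negPf (gmon_neq0 g)).
Qed.

Lemma var_neq0 i : x i != 0. Proof. by rewrite -mon_var mon_neq0. Qed.

Lemma monM g h : mon x (g * h)%g = mon x g * mon x h.
Proof.
rewrite /mon embP.2 mulrACA -big_split; congr (_ * _).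
by apply: eq_bigr => i _; rewrite -[(g * h)%g.2 i]/(g.2 i + h.2 i) expfzDr ?var_neq0.
Qed.

Lemma monV g : mon x g^-1%g = (mon x g)^-1.
Proof. by apply: (mulfI (mon_neq0 g)); rewrite -monM mulgV mon1 divff ?mon_neq0. Qed.

Lemma monX g n : mon x (g ^+ n)%g = mon x g ^+ n.
Proof. by elim: n => [|n IH]; rewrite ?mon1 // expgS exprS monM IH. Qed.

Lemma mon_expz g z : mon x (gexpz g z) = mon x g ^ z.
Proof. by case: z => n; rewrite /gexpz ?monV monX. Qed.

Lemma evM f f' : ev x (f * f') = ev x f * ev x f'.
Proof. exact: (extM monM). Qed.
Lemma evX f n : ev x (f ^+ n) = ev x f ^+ n.
Proof. exact: (extX (mon1 x) monM). Qed.
Lemma evB f f' : ev x (f - f') = ev x f - ev x f'. Proof. exact: extB. Qed.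
Lemma evD f f' : ev x (f + f') = ev x f + ev x f'. Proof. exact: extD. Qed.
Lemma ev0 : ev x 0 = 0. Proof. exact: ext0. Qed.
Lemma ev_gmon g : ev x (gmon g) = mon x g. Proof. exact: ext_gmon. Qed.

Lemma gen_ev (S : K -> Prop) f :
  (forall g, g \in zsupp f -> gen S (mon x g)) -> gen S (ev x f).
Proof.
move=> Sf; apply: (@groupring_ind _ (fun f => gen S (ev x f))).
- by rewrite ev0; exact: gen0.
- by move=> ? ? ? ?; rewrite evB; exact: genB.
- by move=> g /Sf; rewrite ev_gmon.
Qed.

Lemma mon_inj g h : mon x g = mon x h -> g = h.
Proof. by rewrite -!ev_gmon => /xfree /gmon_inj. Qed.

Definition bounded_below k (d : int) (f : zring G) :=
  forall g, g \in zsupp f -> d <= expo k g.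

Lemma bounded0 k d : bounded_below k d 0.
Proof. by move=> g; rewrite -zcoef_neq0 zcoef0 eqxx. Qed.

Lemma boundedB k d f f' : bounded_below k d f -> bounded_below k d f' ->
  bounded_below k d (f - f').
Proof.
move=> bf bf' g; rewrite -zcoef_neq0 zcoefB => fg.
have [/bf //|gf] := boolP (g \in zsupp f); apply: bf'.
by move: fg; rewrite (zcoef_outdom gf) sub0r oppr_eq0 zcoef_neq0.
Qed.

Lemma bounded_gmon k d g : d <= expo k g -> bounded_below k d (gmon g).
Proof. by move=> dg h; rewrite -zcoef_neq0 gmon_coef; case: (g =P h) => [<-|_]; rewrite ?eqxx. Qed.

Lemma boundedM k d d' f f' : bounded_below k d f -> bounded_below k d' f' ->
  bounded_below k (d + d') (f * f').
Proof.
move=> bf bf'; apply: (@groupring_ind _ (fun f => bounded_below k (d + d') (f * f'))).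
- by rewrite mul0r; exact: bounded0.
- by move=> u v bu bv; rewrite mulrBl; exact (boundedB bu bv).
move=> g /bf dg; apply: (@groupring_ind _ (fun f => bounded_below k (d + d') (gmon g * f))).
- by rewrite mulr0; exact: bounded0.
- by move=> u v bu bv; rewrite mulrBr; exact (boundedB bu bv).
by move=> h /bf' dh; rewrite -gmonM; apply: bounded_gmon; rewrite expoM lerD.
Qed.

(** The star ring at [i]: [xi] stands for the mutation of [x i], and the monomials
    are those in the other variables, with arbitrary signs of exponents. *)
Definition star_gens i (xi : K) (a : K) : Prop :=
  (exists2 g, expo i g = 0 & a = mon x g) \/ (a = x i \/ a = xi).

(** As [xk = r / x k], an element of the star ring is a polynomial in [r] whose
    [l]-th coefficient has degree at least [- l] in [x k]. So the part of degree
    [- n] only receives contributions from powers [r ^+ l] with [n <= l]. *)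
Lemma star_graded k (xk : K) (r : zring G) f :
  ev x r = x k * xk -> (forall g, g \in zsupp r -> expo k g = 0) ->
  gen (star_gens k xk) (ev x f) ->
  forall n : nat, exists u, part (expo k) (- n%:Z) f = r ^+ n * u.
Proof.
move=> rE r0 Sf n.
(* [F] is the polynomial obtained by substituting [r / x k] for [xk]. *)
suff [F fF Fb] : exists2 F : {poly zring G}, ev x f = ev x F.[r] &
    forall l : nat, bounded_below k (- l%:Z) F`_l.
  rewrite (xfree fF) horner_coef.
  rewrite (big_morph (part (expo k) (- n%:Z)) (partD _ _) (part0 _ _)).
  apply: (big_ind (fun f => exists u, f = r ^+ n * u)) => [|_ _ [u ->] [v ->]|l _].
  - by exists 0; rewrite mulr0.
  - by exists (u + v); rewrite mulrDr.
  have -> : part (expo k) (- n%:Z) (F`_l * r ^+ l) = r ^+ l * part (expo k) (- n%:Z) F`_l.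
    by rewrite mulrC (part_mulX (expoM k)).
  have [nl|ln] := leqP n l; first by exists (r ^+ (l - n) * part (expo k) (- n%:Z) F`_l);
    rewrite mulrA -exprD subnKC.
  exists 0; rewrite mulr0; apply/eqP; rewrite mulf_eq0; apply/orP; right; apply/eqP.
  apply: groupringP => g; rewrite part_coef zcoef0; case: eqP => // gn.
  apply/eqP; rewrite zcoef_eq0; apply/negP => /Fb; rewrite gn; lia.
elim: {f} (ev x f) / Sf => [_ [[g g0 ->]|[->|->]]||_ _ _ [F -> Fb] _ [F' -> F'b]|_ _ _ [F -> Fb] _ [F' -> F'b]].
- exists (gmon g)%:P; first by rewrite hornerC ev_gmon.
  by case=> [|l]; rewrite coefC /=; [apply: bounded_gmon; rewrite g0 | exact: bounded0].
- exists (gmon (var k))%:P; first by rewrite hornerC ev_gmon mon_var.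
  by case=> [|l]; rewrite coefC /=; [apply: bounded_gmon; rewrite expo_var eqxx | exact: bounded0].
- exists ((gmon (var k)^-1%g)%:P * 'X).
    by rewrite hornerMX hornerC evM ev_gmon rE monV mon_var mulKf ?var_neq0.
  case=> [|l]; rewrite coefMX coefC /=; first exact: bounded0.
  case: l => [|l]; last exact: bounded0.
  by apply: bounded_gmon; rewrite (gradeV (expoM k)) expo_var eqxx.
- exists 1; first by rewrite hornerC -gmon1 ev_gmon mon1.
  case=> [|l]; rewrite coefC /=; last exact: bounded0.
  by rewrite -gmon1; apply: bounded_gmon; rewrite (grade1 (expoM k)).
- exists (F - F'); first by rewrite hornerD hornerN evB.
  by move=> l; rewrite coefB; apply: boundedB.
exists (F * F'); first by rewrite hornerM evM.
move=> l; rewrite coefM.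
apply: (big_ind (bounded_below k (- l%:Z))) => [|f f' bf bf'|l' _].
- exact: bounded0.
- rewrite -(opprK f'); apply: boundedB => //; rewrite -sub0r.
  by apply: boundedB => //; exact: bounded0.
have -> : - l%:Z = - (l' : nat)%:Z + - (l - l')%N%:Z by have := ltn_ord l'; lia.
exact: boundedM.
Qed.

(** The exponent needed in [star_graded] for a part of degree [n] of any sign. *)
Definition negpart (n : int) : nat := if n is Negz k then k.+1 else 0%N.

(** In degree [n >= 0] the condition is empty. *)
Lemma star_divides k (xk : K) (r : zring G) f :
  ev x r = x k * xk -> (forall g, g \in zsupp r -> expo k g = 0) ->
  gen (star_gens k xk) (ev x f) ->
  forall n, exists u, part (expo k) n f = r ^+ negpart n * u.
Proof.
move=> rE r0 Sf [n|n]; last by have := star_graded rE r0 Sf n.+1.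
by exists (part (expo k) n f); rewrite expr0 mul1r; reflexivity.
Qed.

Lemma star_ev k (xk : K) (r : zring G) f :
  ev x r = x k * xk -> gen (star_gens k xk) f -> exists phi, f = ev x phi.
Proof.
move=> rE; elim=> {f} [_ [[g _ ->]|[->|->]]||_ _ _ [u ->] _ [v ->]|_ _ _ [u ->] _ [v ->]].
- by exists (gmon g); rewrite ev_gmon.
- by exists (gmon (var k)); rewrite ev_gmon mon_var.
- exists (r * gmon (var k)^-1%g).
  by rewrite evM ev_gmon rE monV mon_var mulrAC divff ?mul1r ?var_neq0.
- by exists (gmon 1%g); rewrite ev_gmon mon1.
- by exists (u - v); rewrite evB.
- by exists (u * v); rewrite evM.
Qed.

Section RankTwo.
(** Two adjacent mutations seen with the other variables as coefficients: the
    variables are [a] and [b], mutated into [as_] and [bs]; mutating [a] first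
    and then [b] gives [bss], whose exchange relation in the variables
    [as_] and [b] is the third one below, up to the monomial [ka].
    The absolute value of the matrix entry linking them is [e]. *)
Variables (i j : 'I_m) (ij : i != j).
Variables (al be ga de ka : G) (e : nat).
Hypotheses (ali : expo i al = 0) (alj : expo j al = 0)
           (bei : expo i be = 0) (bej : expo j be = 0)
           (gai : expo i ga = 0) (gaj : expo j ga = 0)
           (dei : expo i de = 0) (dej : expo j de = 0)
           (kai : expo i ka = 0) (kaj : expo j ka = 0).
Local Notation M := (mon x).
Let a := x i.
Let b := x j.
Variables (as_ bs bss : K).
Hypothesis asE : a * as_ = M al * b ^+ e + M be.
Hypothesis bsE : b * bs = M ga * a ^+ e + M de.
Hypothesis bssE : b * bss = M ka * (M ga * M be ^+ e + M de * as_ ^+ e).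

Let a0 : a != 0. Proof. exact: var_neq0. Qed.
Let b0 : b != 0. Proof. exact: var_neq0. Qed.

(* [R] consists of the monomials in the other variables, and [T] generates the
   algebra over them by [a], [b] and their mutations; the goal is that the
   intersection of the two star rings is generated by [T]. *)
Let R c := exists g, [/\ expo i g = 0, expo j g = 0 & c = M g].

Let T c := R c \/ [\/ c = a, c = as_, c = b | c = bs].

Variables p q : zring G.
Hypothesis pdef : p = gmon (al * var j ^+ e)%g + gmon be.
Hypothesis qdef : q = gmon (ga * var i ^+ e)%g + gmon de.

Let evp : ev x p = a * as_.
Proof. by rewrite pdef asE evD !ev_gmon monM monX mon_var. Qed.
Let evq : ev x q = b * bs.
Proof. by rewrite qdef bsE evD !ev_gmon monM monX mon_var. Qed.

Let expoX k g n : expo k (g ^+ n)%g = expo k g *+ n.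
Proof. exact: (gradeX (expoM k)). Qed.
Let expoV k g : expo k g^-1%g = - expo k g.
Proof. exact: (gradeV (expoM k)). Qed.

Let binom_homog k al' be' : expo k al' = 0 -> expo k be' = 0 ->
  forall g, g \in zsupp (gmon al' + gmon be') -> expo k g = 0.
Proof.
move=> al0 be0 g; rewrite -zcoef_neq0 zcoefD !gmon_coef.
by case: (al' =P g) => [<- //|_]; case: (be' =P g) => [<- //|_]; rewrite addr0 eqxx.
Qed.

Let p_homog : forall g, g \in zsupp p -> expo i g = 0.
Proof.
rewrite pdef; apply: binom_homog => //.
by rewrite expoM expoX expo_var ali (negPf ij) mul0rn.
Qed.
Let q_homog : forall g, g \in zsupp q -> expo j g = 0.
Proof.
rewrite qdef; apply: binom_homog => //.
by rewrite expoM expoX expo_var gaj eq_sym (negPf ij) mul0rn.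
Qed.

Let asV : as_ = (M al * b ^+ e + M be) * a^-1.
Proof. by rewrite -asE mulrC mulKf. Qed.
Let bsV : bs = (M ga * a ^+ e + M de) * b^-1.
Proof. by rewrite -bsE mulrC mulKf. Qed.

Let mon_corner g : 0 <= expo i g -> 0 <= expo j g -> gen T (M g).
Proof.
move=> gi gj.
pose g0 := (g * (var i ^+ absz (expo i g))^-1 * (var j ^+ absz (expo j g))^-1)%g.
have -> : g = (g0 * var j ^+ absz (expo j g) * var i ^+ absz (expo i g))%g.
  by rewrite /g0 !mulgVK.
have ji : (j == i) = false by rewrite eq_sym (negPf ij).
rewrite monM (monM g0) !monX !mon_var; apply: genM; first apply: genM.
- apply: gen_in; left; exists g0; split=> //; rewrite /g0 !expoM !expoV !expoX !expo_var.
    by rewrite eqxx (negPf ij); lia.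
  by rewrite eqxx ji; lia.
- by apply/genX/gen_in; right; constructor 3.
- by apply/genX/gen_in; right; constructor 1.
Qed.

Let genT_as : gen T as_. Proof. by apply/gen_in; right; constructor 2. Qed.
Let genT_bs : gen T bs. Proof. by apply/gen_in; right; constructor 4. Qed.

Section Linked.
Hypothesis e0 : (0 < e)%N.

(* Laurent polynomials which are polynomial in [b]. *)
Let S0 c := exists2 phi, bounded_below j 0 phi & c = ev x phi.

Let S0B c d : S0 c -> S0 d -> S0 (c - d).
Proof.
by move=> [u bu ->] [v bv ->]; exists (u - v); rewrite ?evB //; apply: boundedB.
Qed.
Let S0M c d : S0 c -> S0 d -> S0 (c * d).
Proof.
move=> [u bu ->] [v bv ->]; exists (u * v); rewrite ?evM //.
by rewrite -[0]addr0; apply: boundedM.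
Qed.
Let S0mon g : 0 <= expo j g -> S0 (M g).
Proof. by move=> g0; exists (gmon g); rewrite ?ev_gmon //; apply: bounded_gmon. Qed.
Let S01 : S0 1. Proof. by rewrite -(mon1 x); apply: S0mon; rewrite (grade1 (expoM j)). Qed.
Let S00 : S0 0. Proof. by rewrite -(subrr 1); apply: S0B. Qed.
Let S0D c d : S0 c -> S0 d -> S0 (c + d).
Proof. by move=> Sc Sd; rewrite -(opprK d); apply: S0B => //; rewrite -sub0r; apply: S0B. Qed.
Let S0X c n : S0 c -> S0 (c ^+ n).
Proof. by move=> Sc; elim: n => [|n IH]; rewrite ?expr0 // exprS; apply: S0M. Qed.
Let S0a : S0 a. Proof. by rewrite /a -mon_var; apply: S0mon; rewrite expo_var; lia. Qed.
Let S0b : S0 b. Proof. by rewrite /b -mon_var; apply: S0mon; rewrite expo_var; lia. Qed.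
Let S0ai : S0 a^-1.
Proof. by rewrite /a -mon_var -monV; apply: S0mon; rewrite expoV expo_var eq_sym (negPf ij). Qed.
Let S0as : S0 as_.
Proof.
rewrite asV; apply: S0M => //; apply: S0D; last by apply: S0mon; rewrite bej.
by apply: S0M; [apply: S0mon; rewrite alj | exact: S0X].
Qed.

(* Modulo [b] the first exchange relation reads [a * as_ = M be] (this is where
   [0 < e] enters), so that [as_ / M be] replaces the inverse of [a]. *)
Let S0_split s : S0 s -> exists t s', [/\ gen T t, S0 s' & s = t + b * s'].
Proof.
case=> phi bphi ->.
apply: (@groupring_ind _ (fun phi => exists t s', [/\ gen T t, S0 s' & ev x phi = t + b * s'])).
- by exists 0, 0; split; [exact: gen0 | | rewrite ev0 mulr0 addr0].
- move=> u v [t [s' [Tt Ss uE]]] [t' [s'' [Tt' Ss' vE]]].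
  exists (t - t'), (s' - s''); split; [exact: genB | exact: S0B |].
  by rewrite evB uE vE; ring.
move=> g /bphi g0; rewrite ev_gmon.
have [gj|gj] := ltP 0 (expo j g).
  exists 0, (M (g * (var j)^-1)%g); split; first exact: gen0.
    by apply: S0mon; rewrite expoM expoV expo_var eqxx; lia.
  by rewrite monM monV mon_var add0r mulrCA divff ?mulr1.
have {g0 gj} gj : expo j g = 0 by apply/le_anti/andP.
have [gi|gi] := leP 0 (expo i g).
  by exists (M g), 0; split; rewrite ?mulr0 ?addr0 //; apply: mon_corner; rewrite ?gj.
pose g0 := (g * var i ^+ absz (expo i g))%g.
have gE : M g = M g0 * a^-1 ^+ absz (expo i g).
  by rewrite monM monX mon_var exprVn mulfK ?expf_neq0.
have Tg0 : gen T (M g0).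
  apply: mon_corner; rewrite expoM expoX expo_var ?eqxx; first by lia.
  by rewrite gj eq_sym (negPf ij); lia.
pose X := (M be)^-1 * as_; pose Y := - ((M be)^-1 * M al * b ^+ e.-1 * a^-1).
have SX : S0 X by apply: S0M => //; rewrite -monV; apply: S0mon; rewrite expoV bej.
have TX : gen T X.
  apply: genM => //; rewrite -monV; apply: mon_corner; rewrite expoV ?bei ?bej.
  - exact: lexx.
  - exact: lexx.
have SY : S0 Y.
  rewrite /Y -sub0r; apply: S0B => //; apply: S0M => //; apply: S0M; last exact: S0X.
  by rewrite -monV -monM; apply: S0mon; rewrite expoM expoV bej alj.
have aE : a^-1 = X + b * Y.
  have be0 : M be != 0 by exact: mon_neq0.
  by rewrite /X /Y asV; case: (e) e0 => // e' _; rewrite exprS /=; field; apply/andP.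
have [t [s' [Tt Ss E]]] : exists t s', [/\ gen T t, S0 s' & a^-1 ^+ absz (expo i g) = t + b * s'].
  elim: (absz _) => [|n [t [s' [Tt Ss E]]]].
    by exists 1, 0; split; rewrite ?mulr0 ?addr0 ?expr0 //; exact: gen1.
  exists (X * t), (X * s' + Y * a^-1 ^+ n); split; first exact: genM.
    by apply: S0D; apply: S0M => //; exact: S0X.
  by rewrite exprS {1}aE mulrDl {1}E; ring.
exists (M g0 * t), (M g0 * s'); split; first exact: genM.
  by apply: S0M => //; apply: S0mon; rewrite expoM gj expoX expo_var; lia.
by rewrite gE E; ring.
Qed.

(* The star ring at [j] is contained in the sum of the algebra generated by [T]
   and of [S0]. It suffices that this sum absorbs products with [bs], and there
   [S0_split] lets [bs] meet a factor [b], where [b * bs] is in [S0]. *)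
Let W c := exists t s, [/\ gen T t, S0 s & c = t + s].

Let WB c d : W c -> W d -> W (c - d).
Proof.
move=> [t [s [Tt Ss ->]]] [t' [s' [Tt' Ss' ->]]]; exists (t - t'), (s - s').
by split; [exact: genB | exact: S0B | ring].
Qed.
Let WS0 c : S0 c -> W c.
Proof. by exists 0, c; split; rewrite ?add0r //; exact: gen0. Qed.
Let WT c : gen T c -> W c.
Proof. by exists c, 0; split; rewrite ?addr0. Qed.
Let WD c d : W c -> W d -> W (c + d).
Proof.
move=> [t [s [Tt Ss ->]]] [t' [s' [Tt' Ss' ->]]]; exists (t + t'), (s + s').
by split; [exact: genD | exact: S0D | ring].
Qed.

Let T_S0 t : gen T t -> forall s, S0 s -> W (t * s).
Proof.
elim=> {t} [c Tc||c d _ IHc _ IHd|c d Tc IHc _ IHd] s Ss.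
- case: Tc => [[g [gi gj ->]]|[->|->|->|->]];
    [|exact/WS0/S0M|exact/WS0/S0M|exact/WS0/S0M|].
    by apply/WS0/S0M => //; apply: S0mon; rewrite gj.
  have [t [s' [Tt Ss' ->]]] := S0_split Ss.
  rewrite mulrDr mulrA (mulrC bs b) bsE; apply: WD; first by apply/WT/genM.
  apply/WS0/S0M => //; apply: S0D; last by apply: S0mon; rewrite dej.
  by apply: S0M; [apply: S0mon; rewrite gaj | exact: S0X].
- by rewrite mul1r; exact: WS0.
- by rewrite mulrBl; apply: WB; [exact: IHc | exact: IHd].
have [t' [s' [Tt Ss' E]]] := IHd s Ss.
by rewrite -mulrA E mulrDr; apply: WD; [apply/WT/genM | exact: IHc].
Qed.

Let star_W f : gen (star_gens j bs) f -> W f.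
Proof.
elim=> {f} [_ [[g g0 ->]|[->|->]]||c d _ IHc _ IHd|_ _ _ [t [s [Tt Ss ->]]] _ [t' [s' [Tt' Ss' ->]]]].
- by apply/WS0/S0mon; rewrite g0.
- exact: WS0.
- exact: WT.
- exact: WS0.
- exact: WB.
rewrite mulrDl; apply: WD; rewrite mulrDr; apply: WD.
- exact/WT/genM.
- exact: T_S0.
- by rewrite mulrC; exact: T_S0.
- exact/WS0/S0M.
Qed.

Let T_star f : gen T f -> gen (star_gens i as_) f.
Proof.
apply: gen_sub => c [[g [gi _ ->]]|[->|->|->|->]].
- by apply: gen_in; left; exists g.
- by apply: gen_in; right; left.
- by apply: gen_in; right; right.
- by apply: gen_in; left; exists (var j); rewrite ?mon_var // expo_var (negPf ij).
rewrite bsV; apply: genM; last first.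
  by apply: gen_in; left; exists (var j)^-1%g; rewrite ?monV ?mon_var // expoV expo_var (negPf ij).
apply: genD; last by apply: gen_in; left; exists de.
apply: genM; first by apply: gen_in; left; exists ga.
by apply/genX/gen_in; right; left.
Qed.

Let bounded_divisor n f : bounded_below j 0 (p ^+ n * f) -> bounded_below j 0 f.
Proof.
elim: n f => [|n IH] f; first by rewrite expr0 mul1r.
rewrite exprSr -mulrA => /IH H; rewrite pdef in H; apply: (nonneg_divisor (expoM j) bej) H.
by rewrite expoM alj expoX expo_var eqxx; lia.
Qed.

(** By the decomposition [W] one may assume that the element is polynomial in
    [b]. Its part of degree [- n] in [a] is a multiple of [p ^+ n], with a
    quotient still polynomial in [b] by [nonneg_divisor]; since [p = a * as_],
    the part is [as_ ^+ n] times a polynomial in [a] and [b]. *)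
Lemma rank_two_linked f :
  gen (star_gens i as_) f -> gen (star_gens j bs) f -> gen T f.
Proof.
move=> fi /star_W [t [s [Tt Ss fE]]].
have si : gen (star_gens i as_) s.
  by rewrite (_ : s = f - t); [apply: genB => //; exact: T_star | rewrite fE; ring].
rewrite fE; apply: genD => //; case: Ss si => phi bphi -> si.
have H := star_graded evp p_homog si.
apply: (@part_ind _ (expo i) (fun phi => gen T (ev x phi))).
- by rewrite ev0; exact: gen0.
- by move=> u v Tu Tv; rewrite evD; exact: genD.
move=> k; have [k0|k0] := leP 0 k.
  apply: gen_ev => g /part_supp [gk gphi]; apply: mon_corner; first by rewrite gk.
  exact: bphi.
pose n := absz k; have kn : k = - n%:Z by rewrite /n; lia.
have [u uE] := H n; rewrite kn.
have uE' : part (expo i) (- n%:Z) phi = p ^+ n * part (expo i) (- n%:Z) u.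
  by rewrite -(@part_mulX _ _ (expoM i) _ p u n p_homog) -uE part_id.
have bu : bounded_below j 0 (part (expo i) (- n%:Z) u).
  by apply: (@bounded_divisor n); rewrite -uE' => g /part_supp [_ /bphi].
rewrite uE' evM evX evp exprMn mulrC mulrA; apply: genM; last exact: genX.
rewrite -[a]mon_var -monX -ev_gmon mulrC -evM.
apply: gen_ev => g; rewrite -zcoef_neq0 gmon_mul_coef zcoef_neq0 => gu.
have [gi _] := part_supp gu; have gj := bu _ gu.
move: gi gj; rewrite !expoM !expoV !expoX !expo_var eqxx eq_sym (negPf ij) => gi gj.
by apply: mon_corner; lia.
Qed.
End Linked.

(* The powers of [p = a * as_] and [q = b * bs] absorb the negative exponents
   of [a] and [b] in a part of bidegree [(n, n')]. *)
Let corner_gen n n' (t : zring G) :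
  gen T (ev x (q ^+ negpart n' * (p ^+ negpart n * part (expo j) n' (part (expo i) n t)))).
Proof.
have : forall g, g \in zsupp (part (expo j) n' (part (expo i) n t)) -> expo i g = n /\ expo j g = n'.
  by move=> g /part_supp [gj /part_supp [gi _]].
move: (part (expo j) n' _) => {}t tsupp.
rewrite !evM !evX evp evq !exprMn.
have -> : b ^+ negpart n' * bs ^+ negpart n' * (a ^+ negpart n * as_ ^+ negpart n * ev x t)
        = bs ^+ negpart n' * as_ ^+ negpart n * (M (var i ^+ negpart n * var j ^+ negpart n')%g * ev x t).
  by rewrite monM !monX !mon_var -/a -/b; ring.
apply: genM; first by apply: genM; exact: genX.
rewrite -ev_gmon -evM; apply: gen_ev => g.
rewrite -zcoef_neq0 gmon_mul_coef zcoef_neq0 => /tsupp [].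
rewrite !expoM !expoV !expoM !expoX !expo_var !eqxx (negPf ij) eq_sym (negPf ij).
by case: (n) => n1 /=; case: (n') => n1' /= gi gj; apply: mon_corner; lia.
Qed.

Section Unlinked.
Hypothesis e0 : e = 0%N.
Variable w : G -> int.
Hypotheses (wM : forall g h, w (g * h)%g = w g + w h).
Hypotheses (wp : w al = w be) (wq : w ga <> w de).

(** When [e = 0] neither binomial involves [a] or [b]. A part of given bidegree is
    divisible by a power of [p] and by a power of [q]; coprimality makes it
    divisible by their product, and [corner_gen] applies. *)
Lemma rank_two_unlinked f :
  gen (star_gens i as_) f -> gen (star_gens j bs) f -> gen T f.
Proof.
move=> fi fj; have [phi phiE] := star_ev evp fi.
rewrite phiE in fi fj *.
have pE : p = gmon al + gmon be by rewrite pdef e0 expg0 mulg1; reflexivity.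
have qE : q = gmon ga + gmon de by rewrite qdef e0 expg0 mulg1; reflexivity.
have qi g : g \in zsupp q -> expo i g = 0 by rewrite qE; apply: binom_homog.
have pj g : g \in zsupp p -> expo j g = 0 by rewrite pE; apply: binom_homog.
have p0 : p != 0 by rewrite pE gmonD_neq0.
have divp := star_divides evp p_homog fi.
have divq := star_divides evq q_homog fj.
apply: (@part_ind _ (expo i) (fun u => gen T (ev x u))).
- by rewrite ev0; exact: gen0.
- by move=> u v Tu Tv; rewrite evD; exact: genD.
move=> n; apply: (@part_ind _ (expo j) (fun u => gen T (ev x u))).
- by rewrite ev0; exact: gen0.
- by move=> u v Tu Tv; rewrite evD; exact: genD.
move=> n0; have [u uE] := divp n; have [v vE] := divq n0.
set r := negpart n in uE; set r' := negpart n0 in vE.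
have X1 : part (expo j) n0 (part (expo i) n phi) = p ^+ r * part (expo j) n0 u.
  rewrite uE (@part_mulX _ _ (expoM j) _ p u r pj); reflexivity.
have X2 : part (expo j) n0 (part (expo i) n phi) = q ^+ r' * part (expo i) n v.
  rewrite part_comm vE (@part_mulX _ _ (expoM i) _ q v r' qi); reflexivity.
have cop (u' v' : zring G) : q * u' = p * v' -> exists t : zring G, u' = p * t.
  by rewrite pE qE; exact (@binomial_coprime _ w al be ga de u' v' wM wp wq).
have [t tE] := coprimeX p0 cop (etrans (esym X1) X2).
have X3 := etrans X2 (congr1 ( *%R (q ^+ r')) tE).
have X4 := congr1 (fun z => part (expo j) n0 (part (expo i) n z)) X3.
have X5 := bipart_mulX n0 n r' r t (expoM j) (expoM i) q_homog qi pj p_homog.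
have XE := etrans (esym (bipart_id (expo j) (expo i) n0 n phi)) (etrans X4 X5).
exact (eq_ind_r (fun z => gen T (ev x z)) (corner_gen n n0 t) XE).
Qed.
End Unlinked.

(** Modulo [b], the power [(a * as_) ^+ e] is [M be ^+ e], so that
    [as_ ^+ e * bs] agrees with [bss / M ka] up to an element of [S]: this brings
    [bs] into the star ring of the mutated seed, where [as_] is
    invertible. *)
Lemma rank_two_target (S : K -> Prop) f :
    (forall g, expo i g = 0 -> expo j g = 0 -> gen S (M g)) ->
    as_ != 0 -> gen S as_ -> gen S as_^-1 -> gen S b -> gen S bss ->
  gen T f -> gen S f.
Proof.
move=> SR as0 Sas Sas' Sb Sbss.
have SM g : expo i g = 0 -> expo j g = 0 -> gen S (M g) by exact: SR.
have [s Ss PE] : exists2 s, gen S s & (a * as_) ^+ e = M be ^+ e + b * s.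
  rewrite asE; case: (e) => [|e'].
    by exists 0; rewrite ?mulr0 ?addr0 //; exact: gen0.
  move: {2 3}e'.+1; elim=> [|n [s Ss IH]].
    by exists 0; rewrite ?mulr0 ?addr0 //; exact: gen0.
  exists (M al * b ^+ e' * (M be ^+ n + b * s) + M be * s).
    apply: genD; last by apply: genM => //; exact: SM.
    apply: genM; first by apply: genM; [exact: SM | exact: genX].
    by apply: genD; [apply/genX/SM | exact: genM].
  by rewrite exprS IH !exprS; ring.
have bsE' : bs = as_^-1 ^+ e * ((M ka)^-1 * bss + M ga * s).
  have ka0 : M ka != 0 by exact: mon_neq0.
  apply: (mulfI b0); apply: (mulfI (expf_neq0 e as0)).
  have -> : as_ ^+ e * (b * (as_^-1 ^+ e * ((M ka)^-1 * bss + M ga * s)))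
     = (M ka)^-1 * (b * bss) + M ga * (b * s).
    by rewrite exprVn; field; rewrite ka0 expf_neq0.
  rewrite bsE bssE mulKf // mulrDr.
  have -> : as_ ^+ e * (M ga * a ^+ e) = M ga * (a * as_) ^+ e by rewrite exprMn; ring.
  by rewrite PE; ring.
apply: gen_sub => c [[g [gi gj ->]]|[->|->|->|->]] //; first exact: SM.
  rewrite (_ : a = as_^-1 * (M al * b ^+ e + M be)); last by rewrite -asE mulrCA mulVf ?mulr1.
  apply: genM => //; apply: genD; last exact: SM.
  by apply: genM; [exact: SM | exact: genX].
rewrite bsE'; apply: genM; first exact: genX.
apply: genD; apply: genM => //; last exact: SM.
by rewrite -monV; apply: SM; rewrite expoV ?kai ?kaj oppr0.
Qed.

Lemma rank_two (S : K -> Prop) f :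
    (e = 0%N -> exists2 w : G -> int, forall g h, w (g * h)%g = w g + w h &
       w al = w be /\ w ga <> w de) ->
    (forall g, expo i g = 0 -> expo j g = 0 -> gen S (M g)) ->
    as_ != 0 -> gen S as_ -> gen S as_^-1 -> gen S b -> gen S bss ->
  gen (star_gens i as_) f -> gen (star_gens j bs) f -> gen S f.
Proof.
move=> unlinked SR as0 Sas Sas' Sb Sbss fi fj; apply: rank_two_target => //.
have [e0|e0] := posnP e; last exact: rank_two_linked.
by have [w wM [wp wq]] := unlinked e0; apply: (rank_two_unlinked e0 wM).
Qed.
End RankTwo.
End Free.
End Frame.

(** * Mutations *)

Lemma pospartB (z : int) : pospart z - pospart (- z) = z.
Proof. by rewrite /pospart; lia. Qed.

Lemma pospartN (z : int) : pospart (- z) = pospart z - z.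
Proof. by have := pospartB z; lia. Qed.

Section Matrices.
Variable m : nat.
Implicit Types (B : 'M[int]_m) (i j k : 'I_m).

Definition mutB k B : 'M[int]_m := \matrix_(i, j) if (i == k) || (j == k) then - B i j
    else B i j + ((B i k * `|B k j| + `|B i k| * B k j) %/ 2)%Z.

(** The subtraction-free form of the exchange rule for matrices; it also shows
    that the division by two is exact. *)
Lemma half_exchange (u v : int) : ((u * `|v| + `|u| * v) %/ 2)%Z =
  pospart u * pospart v - pospart (- u) * pospart (- v).
Proof.
have [u0|u0] := leP 0 u; have [v0|v0] := leP 0 v.
- rewrite (_ : u * `|v| + `|u| * v = u * v * 2) ?mulzK // /pospart; nia.
- rewrite (_ : u * `|v| + `|u| * v = 0) ?div0z // /pospart; nia.
- rewrite (_ : u * `|v| + `|u| * v = 0) ?div0z // /pospart; nia.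
- rewrite (_ : u * `|v| + `|u| * v = - (u * v) * 2) ?mulzK // /pospart; nia.
Qed.

Lemma mutBE k B i j : mutB k B i j = if (i == k) || (j == k) then - B i j
  else B i j + (pospart (B i k) * pospart (B k j) - pospart (- B i k) * pospart (- B k j)).
Proof. by rewrite mxE half_exchange. Qed.

Lemma skewE B : B^T = - B -> forall i j, B i j = - B j i.
Proof. by move=> skB i j; have /matrixP/(_ j i) := skB; rewrite !mxE. Qed.

Lemma skew0 B : B^T = - B -> forall i, B i i = 0.
Proof. by move=> skB i; have := skewE skB i i; lia. Qed.

Lemma mutB_skew k B : B^T = - B -> (mutB k B)^T = - mutB k B.
Proof.
move=> skB; apply/matrixP => i j; rewrite [LHS]mxE [RHS]mxE !mutBE orbC.
case: ifP => _; first by rewrite (skewE skB j i).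
rewrite (skewE skB j k) (skewE skB k i) (skewE skB j i) !opprK; ring.
Qed.

Lemma mutBK k B : B^T = - B -> mutB k (mutB k B) = B.
Proof.
move=> skB; apply/matrixP => i j; rewrite !mutBE.
case: ifP => ijk; rewrite ijk ?opprK //; rewrite !eqxx !orbT /= !opprK; ring.
Qed.
End Matrices.

Section YPattern.
Variables (m : nat) (P : semifieldType).
Implicit Types (B : 'M[int]_m) (y : {ffun 'I_m -> P}) (i j k : 'I_m).

Definition mutY k B y : {ffun 'I_m -> P} :=
  [ffun j => if j == k then (y k)^-1%g
    else (y j * gexpz (y k) (pospart (B k j))
              * gexpz (y k ⊕ 1) (- B k j)%R)%g].

Lemma sfaddV (p : P) : (p^-1 ⊕ 1 = (p ⊕ 1) * p^-1)%g.
Proof. by rewrite sfmulDl mulgV mul1g sfaddC. Qed.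

Lemma mutYK k B y : mutY k (mutB k B) (mutY k B y) = y.
Proof.
apply/ffunP => j; rewrite !ffunE eqxx; case: eqP => [->|/eqP jk]; first by rewrite invgK.
rewrite mutBE eqxx /= opprK sfaddV.
set u := y k; set v := (u ⊕ 1)%g; set b := B k j.
rewrite gexpzMl !gexpzV -!gexpzN -!mulgA (mulgA (gexpz v _)) (sfmulC (gexpz v _)).
rewrite -!mulgA (mulgA (gexpz v _)) -gexpzD addNr mul1g -!gexpzD.
rewrite (_ : pospart b + (- pospart (- b) + - b) = 0) ?mulg1 //.
by have := pospartB b; lia.
Qed.
End YPattern.

Section YHom.
Variables (m : nat) (P Q : semifieldType) (phi : P -> Q).
Hypothesis (phiM : {morph phi : p q / (p * q)%g >-> (p * q)%g}).
Hypothesis (phiD : {morph phi : p q / (p ⊕ q)%g >-> (p ⊕ q)%g}).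

Lemma hom1 : phi 1%g = 1%g.
Proof. by apply: (@mulIg Q (phi 1%g)); rewrite -phiM !mul1g. Qed.

Lemma homV p : phi p^-1%g = (phi p)^-1%g.
Proof. by apply: (@mulIg Q (phi p)); rewrite -phiM !mulVg hom1. Qed.

Lemma homX p n : phi (p ^+ n)%g = (phi p ^+ n)%g.
Proof. by elim: n => [|n IH]; rewrite ?hom1 // !expgS phiM IH. Qed.

Lemma hom_gexpz p z : phi (gexpz p z) = gexpz (phi p) z.
Proof. by case: z => n; rewrite /gexpz ?homV homX. Qed.

Lemma hom_mutY k (B : 'M[int]_m) (y : {ffun 'I_m -> P}) :
  [ffun i => phi (mutY k B y i)] = mutY k B [ffun i => phi (y i)].
Proof.
apply/ffunP => j; rewrite !ffunE; case: ifP => _; first exact: homV.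
by rewrite !phiM !hom_gexpz phiD hom1.
Qed.
End YHom.

Section Mutation.
Variables (m : nat) (P : semifieldType) (K : fieldType) (emb : P -> K).
Local Notation seed := (preseed m P K).
Implicit Types (s : seed) (i j k l : 'I_m) (sg : 'S_m).

Definition mutX k s : {ffun 'I_m -> K} :=
  [ffun j => if j == k then
      (emb (coeffs s k) * \prod_i cluster s i ^ pospart (exmat s i k)
         + \prod_i cluster s i ^ pospart (- exmat s i k))
      / (emb (coeffs s k ⊕ 1)%g * cluster s k)
    else cluster s j].

(** The mutation rule for an arbitrary map [emb] from the coefficients to the
    field, which lets seeds in different kinds of fields be treated alike. *)
Definition mut k s : seed :=
  Preseed (mutX k s) (mutY k (exmat s) (coeffs s)) (mutB k (exmat s)).

Definition muts (ks : seq 'I_m) s : seed := foldl (fun s k => mut k s) s ks.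

Lemma muts_cat ks ls s : muts (ks ++ ls) s = muts ls (muts ks s).
Proof. exact: foldl_cat. Qed.

Lemma mut_renumber sg k s : mut k (renumber sg s) = renumber sg (mut (sg k) s).
Proof.
congr Preseed.
- apply/ffunP => j; rewrite !ffunE (inj_eq perm_inj); case: ifP => // _.
  congr (_ / _); congr (_ * _ + _).
    rewrite [RHS](reindex_inj (@perm_inj _ sg)); apply: eq_bigr => i _.
    by rewrite !ffunE mxE.
  rewrite [RHS](reindex_inj (@perm_inj _ sg)); apply: eq_bigr => i _.
  by rewrite !ffunE mxE.
- by apply/ffunP => j; rewrite !ffunE (inj_eq perm_inj) !mxE.
by apply/matrixP => i j; rewrite !mxE !(inj_eq perm_inj).
Qed.

End Mutation.

Lemma mutationE (m : nat) (P : semifieldType) (F : fieldType)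
    (iota : {rmorphism ratfield P -> F}) k (s : preseed m P F) :
  mutation iota k s = mut (sfemb iota) k s.
Proof. by case: s. Qed.

(** * Exchange relations *)

Section ExchangeRelations.
Variables (m : nat) (P : semifieldType) (K : fieldType) (emb : P -> K).
Hypothesis embP : multiplicative_map emb.
Local Notation seed := (preseed m P K).
Local Notation G := (gam m P).
Implicit Types (s : seed) (i j k l : 'I_m) (g : G).

(** The two monomials of the exchange relation at [k], normalised by
    the factor [y_k ⊕ 1]. *)
Definition hplus s k : G :=
  ((coeffs s k * (coeffs s k ⊕ 1)^-1)%g, fun l => pospart (exmat s l k)).
Definition hminus s k : G :=
  (((coeffs s k ⊕ 1)^-1)%g, fun l => pospart (- exmat s l k)).

Definition good s := alg_free emb (cluster s) /\ (exmat s)^T = - exmat s.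

Lemma mut_cluster_neq k s l : l != k -> cluster (mut emb k s) l = cluster s l.
Proof. by move=> lk; rewrite ffunE (negPf lk). Qed.

Lemma exchange_relation s k : good s ->
  cluster s k * cluster (mut emb k s) k
    = mon emb (cluster s) (hplus s k) + mon emb (cluster s) (hminus s k).
Proof.
move=> [xfree _]; rewrite ffunE eqxx /mon embP.2 embV //=.
have x0 := var_neq0 embP xfree k.
have y0 := emb_neq0 embP (coeffs s k ⊕ 1)%g.
by field; rewrite x0 y0.
Qed.

Lemma expo_hplus s k : good s -> expo k (hplus s k) = 0.
Proof. by move=> [_ skB]; rewrite /expo /= skew0. Qed.

Lemma expo_hminus s k : good s -> expo k (hminus s k) = 0.
Proof. by move=> [_ skB]; rewrite /expo /= skew0. Qed.

Definition binom s k : zring G := gmon (hplus s k) + gmon (hminus s k).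

Lemma binom_supp s k g : good s -> g \in zsupp (binom s k) -> expo k g = 0.
Proof.
move=> gs; rewrite -zcoef_neq0 zcoefD !gmon_coef.
case: (_ =P g) => [<- _|_]; first exact: expo_hplus.
by case: (_ =P g) => [<- _|_]; [exact: expo_hminus | rewrite addr0 eqxx].
Qed.

Lemma ev_binom s k : good s ->
  ev emb (cluster s) (binom s k) = cluster s k * cluster (mut emb k s) k.
Proof. by move=> gs; rewrite exchange_relation // evD !ev_gmon. Qed.

Lemma binom_neq0 s k : binom s k != 0.
Proof. exact: gmonD_neq0. Qed.

Lemma mut_var_neq0 s k : good s -> cluster (mut emb k s) k != 0.
Proof.
move=> gs; have [xfree _] := gs.
have := binom_neq0 s k; apply: contraNneq => xk0.
by apply/eqP/xfree; rewrite ev_binom // xk0 mulr0 ev0.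
Qed.

Lemma prod_mut (s : seed) k (n : 'I_m -> int) : n k = 0 ->
  \prod_i cluster (mut emb k s) i ^ n i = \prod_i cluster s i ^ n i.
Proof.
move=> nk; apply: eq_bigr => i _; have [->|ik] := eqVneq i k; last by rewrite mut_cluster_neq.
by rewrite nk !expr0z.
Qed.

Lemma mutK s k : good s -> mut emb k (mut emb k s) = s.
Proof.
move=> gs; have [xfree skB] := gs; case: s gs xfree skB => x y B gs xfree skB.
congr Preseed; last exact: mutBK; last exact: mutYK.
apply/ffunP => j; rewrite ffunE; case: eqP => [->|/eqP jk]; last exact: mut_cluster_neq.
rewrite !prod_mut; try by rewrite mutBE eqxx /= skew0 ?oppr0.
have rel := exchange_relation k gs; have x'0 := mut_var_neq0 k gs.
set x' := cluster (mut _ _ _) k in rel x'0 *.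
rewrite /= ffunE eqxx sfaddV !embP.2 !(embV embP).
have y0 := emb_neq0 embP (y k); have y10 := emb_neq0 embP (y k ⊕ 1)%g.
have E1 : \prod_i x i ^ pospart (mutB k B i k) = \prod_i x i ^ pospart (- B i k).
  by apply: eq_bigr => i _; rewrite mutBE eqxx orbT.
have E2 : \prod_i x i ^ pospart (- mutB k B i k) = \prod_i x i ^ pospart (B i k).
  by apply: eq_bigr => i _; rewrite mutBE eqxx orbT opprK.
rewrite E1 E2; move: rel; rewrite /mon /= embP.2 (embV embP).
set M := \prod_i x i ^ pospart (B i k); set N := \prod_i x i ^ pospart (- B i k) => rel.
have -> : x k = (emb (y k) / emb (y k ⊕ 1)%g * M + (emb (y k ⊕ 1)%g)^-1 * N) / x'.
  by rewrite -rel mulfK.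
by field; rewrite y0 y10 x'0.
Qed.

Lemma mon_mut s k g : good s ->
  mon emb (cluster (mut emb k s)) g
   = mon emb (cluster s) (g * gexpz (var P k) (- expo k g))%g
     * cluster (mut emb k s) k ^ expo k g.
Proof.
move=> gs; have [xfree _] := gs.
rewrite (monM embP xfree) (mon_expz embP xfree) (mon_var embP).
rewrite /mon (bigD1 k) //= [in RHS](bigD1 k) //=.
rewrite (eq_bigr (fun i => cluster s i ^ g.2 i)); last by move=> i ik; rewrite mut_cluster_neq.
have xE : cluster s k ^ g.2 k * cluster s k ^ (- expo k g) = 1.
  by rewrite -expfzDr ?(var_neq0 embP xfree) // subrr expr0z.
rewrite -[LHS]mulr1 -xE; ring.
Qed.
End ExchangeRelations.

(** * Mutation preserves algebraic independence *)

Section Freeness.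
Variables (m : nat) (P : semifieldType) (K : fieldType) (emb : P -> K).
Hypothesis embP : multiplicative_map emb.
Local Notation seed := (preseed m P K).
Local Notation G := (gam m P).
Implicit Types (s : seed) (i j k l : 'I_m) (g : G).

Lemma expo_gexpz i g z : expo i (gexpz g z) = expo i g * z.
Proof.
rewrite /expo (@hom_gexpz G (trop 'I_m) snd) //; exact: gexpz_trop.
Qed.

Section Flip.
Variables (k : 'I_m) (p : zring G).
Hypothesis p_homog : forall g, g \in zsupp p -> expo k g = 0.

(** Replaces the exponent [n] of [x_k] by [- n]. *)
Definition flip g : G := (g * gexpz (var P k) (- (expo k g *+ 2)))%g.

Lemma expo_flip g : expo k (flip g) = - expo k g.
Proof. by rewrite /flip expoM expo_gexpz expo_var eqxx; lia. Qed.

Lemma flipK g : flip (flip g) = g.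
Proof.
rewrite {1}/flip expo_flip /flip -mulgA -gexpzD (_ : _ + _ = 0) ?mulg1 //; lia.
Qed.

Definition gflip : zring G -> zring G := ext (fun g => gmon (flip g)).

Lemma gflipB u v : gflip (u - v) = gflip u - gflip v. Proof. exact: extB. Qed.

Lemma gflipK f : gflip (gflip f) = f.
Proof.
apply: (@groupring_ind _ (fun f => gflip (gflip f) = f)).
- by rewrite /gflip !ext0.
- by move=> u v uE vE; rewrite (gflipB u v) (gflipB (gflip u) (gflip v)) uE vE; reflexivity.
- by move=> g _; rewrite /gflip !ext_gmon flipK.
Qed.

(** Rewriting a Laurent polynomial in the mutated cluster by [x_k' = p / x_k]
    turns an exponent [n] of [x_k'] into [p ^ n] and an exponent [- n] of [x_k];
    the factor [p ^ N] makes the powers of [p] nonnegative. *)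
Definition clear (N : nat) : zring G -> zring G :=
  ext (fun g => gmon (flip g) * p ^+ absz (N%:Z + expo k g)).

Lemma clearB N u v : clear N (u - v) = clear N u - clear N v.
Proof. exact: extB. Qed.

Lemma part_clear (N : nat) (f : zring G) n :
  (forall g, g \in zsupp f -> - N%:Z <= expo k g) ->
  part (expo k) (- n) (clear N f) = p ^+ absz (N%:Z + n) * gflip (part (expo k) n f).
Proof.
move=> fN; apply: (@groupring_ind _ (fun f => part (expo k) (- n) (clear N f)
  = p ^+ absz (N%:Z + n) * gflip (part (expo k) n f))).
- by rewrite /clear /gflip part0 !ext0 part0 mulr0.
- move=> u v uE vE; rewrite (clearB N u v) (partB _ _ (clear N u)) uE vE (partB _ _ u v).
  by rewrite gflipB mulrBr; reflexivity.
move=> g /fN gN; rewrite /clear /gflip ext_gmon part_gmon mulrC.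
rewrite (part_mulX (expoM k)) // part_gmon expo_flip eqr_opp.
by case: eqP => [<-|_]; rewrite ?ext_gmon ?ext0 ?mulr0.
Qed.
End Flip.

(** If a Laurent polynomial vanishes on the mutated cluster, so does its cleared
    form on the original one; each homogeneous part of the latter is, up to a
    power of the nonzero binomial, a flipped part of the former. *)
Lemma alg_free_mut s k : good emb s -> alg_free emb (cluster (mut emb k s)).
Proof.
move=> gs; have [xfree skB] := gs; set x' := cluster (mut emb k s).
suff ker f : ev emb x' f = 0 -> f = 0.
  by move=> f f' ff'; apply/subr0_eq/ker; rewrite evB ff' subrr.
move=> f0; have [N Nf] := supp_bound (expo k) f.
have p_homog g : g \in zsupp (binom s k) -> expo k g = 0.
  by move=> gb; apply: binom_supp gs gb.
have E : ev emb (cluster s) (clear k (binom s k) N f)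
    = ev emb x' f * ev emb (cluster s) (binom s k) ^+ N.
  apply: (@groupring_ind _ (fun f => ev emb (cluster s) (clear k (binom s k) N f)
    = ev emb x' f * ev emb (cluster s) (binom s k) ^+ N)).
  - by rewrite /clear /ev !ext0 mul0r.
  - move=> u v uE vE; rewrite (clearB k _ N u v) (evB _ _ u v) (evB _ _ (clear _ _ _ u)).
    by rewrite uE vE mulrBl; reflexivity.
  move=> g /Nf /andP [gN _]; rewrite /clear ext_gmon (evM embP xfree) (evX embP xfree).
  rewrite !ev_gmon (mon_mut embP) // /flip !(monM embP xfree) !(mon_expz embP xfree) !(mon_var embP).
  rewrite ev_binom // -/x' !exprnP.
  have -> : Posz (absz (N%:Z + expo k g)) = N%:Z + expo k g by lia.
  have x0 : cluster s k * x' k != 0.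
    by rewrite mulf_neq0 ?(mut_var_neq0 embP) ?(var_neq0 embP xfree).
  have xk0 : cluster s k != 0 by rewrite (var_neq0 embP xfree).
  have xE : cluster s k ^ (- expo k g) = cluster s k ^ (expo k g *- 2) * cluster s k ^ expo k g.
    by rewrite -expfzDr //; congr (_ ^ _); lia.
  by rewrite expfzDr // [_ ^ expo k g in LHS]expfzMl xE; ring.
have C0 : clear k (binom s k) N f = 0 by apply: xfree; rewrite E f0 mul0r ev0.
apply: (@part_ind _ (expo k) (fun f => f = 0)) => // [u v -> ->|n]; first by rewrite addr0.
have := @part_clear k (binom s k) p_homog N f n.
rewrite C0 part0 => H; have {H} := H _.
move=> /(_ (fun g gf => ltW (proj1 (andP (Nf g gf))))) /esym/eqP.
rewrite mulf_eq0 expf_eq0 (negPf (binom_neq0 s k)) andbF /= => /eqP G0.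
by rewrite -[LHS](gflipK k) G0 /gflip ext0.
Qed.

Lemma good_mut s k : good emb s -> good emb (mut emb k s).
Proof. by move=> gs; split; [exact: alg_free_mut | apply: mutB_skew; case: gs]. Qed.

Lemma good_muts s ks : good emb s -> good emb (muts emb ks s).
Proof. by elim: ks s => //= k ks IH s gs; apply/IH/good_mut. Qed.

Lemma muts_rev s ks : good emb s -> muts emb (rev ks) (muts emb ks s) = s.
Proof.
elim: ks s => //= k ks IH s gs; rewrite rev_cons -cats1 muts_cat IH /=; first exact: mutK.
exact: good_mut.
Qed.
End Freeness.

(** * Star rings under mutation *)

(* Lets products in a semifield be reordered by [AC]. *)
HB.instance Definition _ (P : semifieldType) :=
  SemiGroup.isCommutativeLaw.Build P (@monoid.mul P) (@sfmulC P).

Section GroupIdentities.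
Variable P : semifieldType.
Implicit Types y z c d u v : P.
Local Open Scope group_scope.

Lemma exchange_coef_minus y z c d :
  d^-1 = (y * z * d^-1) * (y * c^-1)^-1 * c^-1 * z^-1.
Proof.
rewrite invgM invgK [RHS](AC (3*2*1*1) (3*(1*5)*(4*6)*(2*7))).
by rewrite /= !mulgV !mulg1.
Qed.

Lemma exchange_coef_plus y z c d :
  (y * z) * d^-1 = d^-1 * (c^-1)^-1 * (y * c^-1) * z.
Proof.
rewrite invgK [RHS](AC (2*2*1) (3*5*1*(2*4))).
by rewrite /= mulgV mulg1.
Qed.
End GroupIdentities.

Section StarRings.
Variables (m : nat) (P : semifieldType) (K : fieldType) (emb : P -> K).
Hypothesis embP : multiplicative_map emb.
Local Notation seed := (preseed m P K).
Local Notation G := (gam m P).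
Implicit Types (s : seed) (i j k l : 'I_m) (g : G).

(** The monomial without its power of [x_k]. *)
Definition drop k g : G := (g.1, fun l => if l == k then 0 else g.2 l).

Lemma expo_drop k g : expo k (drop k g) = 0.
Proof. by rewrite /expo /= eqxx. Qed.
Lemma expo_drop_neq k l g : l != k -> expo l (drop k g) = expo l g.
Proof. by move=> lk; rewrite /expo /= (negPf lk). Qed.

Lemma gam_eq g h : g.1 = h.1 -> (forall l, expo l g = expo l h) -> g = h.
Proof. by case: g h => [p n] [q n'] /= -> nn'; congr (_, _); apply: boolp.funext. Qed.

Lemma gam_coefM g h : (g * h)%g.1 = (g.1 * h.1)%g. Proof. by []. Qed.
Lemma coef_gexpz g z : (gexpz g z).1 = gexpz g.1 z.
Proof. by rewrite (@hom_gexpz G P fst). Qed.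

Lemma gam_coefV g : (g^-1)%g.1 = (g.1)^-1%g. Proof. by []. Qed.
Lemma coef_drop k g : (drop k g).1 = g.1. Proof. by []. Qed.
Lemma coef_hplus s k : (hplus s k).1 = (coeffs s k * (coeffs s k ⊕ 1)^-1)%g.
Proof. by []. Qed.
Lemma coef_hminus s k : (hminus s k).1 = (coeffs s k ⊕ 1)^-1%g.
Proof. by []. Qed.

Lemma expo_inv i g : expo i g^-1%g = - expo i g. Proof. by []. Qed.

Lemma gexpz1g z : gexpz (1%g : P) z = 1%g.
Proof. by case: z => n; rewrite /gexpz expg1n ?invg1. Qed.

Lemma dropE k g : drop k g = (g * gexpz (var P k) (- expo k g))%g.
Proof.
apply: gam_eq => [|l]; first by rewrite gam_coefM coef_gexpz gexpz1g mulg1.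
rewrite expoM expo_gexpz expo_var; case: (eqVneq l k) => [->|lk].
  by rewrite expo_drop; lia.
by rewrite expo_drop_neq //; lia.
Qed.

Lemma mon_drop x k g : alg_free emb x -> mon emb x g = mon emb x (drop k g) * x k ^ expo k g.
Proof.
move=> xfree; rewrite -(mon_var embP x k) -(mon_expz embP xfree) -(monM embP xfree) dropE.
by rewrite -mulgA -gexpzD addNr mulg1.
Qed.

Lemma mon_mut_drop s k g : good emb s ->
  mon emb (cluster (mut emb k s)) g
   = mon emb (cluster s) (drop k g) * cluster (mut emb k s) k ^ expo k g.
Proof. by move=> gs; rewrite (mon_mut embP) // dropE. Qed.

Section StarExchange.
Variables (s : seed) (i j : 'I_m).
Hypotheses (gs : good emb s) (ij : i != j).
Let s' := mut emb i s.
Let e := absz (exmat s i j).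

Let skB : (exmat s)^T = - exmat s. Proof. by case: gs. Qed.
Let xfree : alg_free emb (cluster s). Proof. by case: gs. Qed.
Let gs' : good emb s'. Proof. exact: good_mut. Qed.
Let ji : j != i. Proof. by rewrite eq_sym. Qed.

Let expo_h' : expo i (hplus s' j) = pospart (- exmat s i j) /\ expo i (hminus s' j) = pospart (exmat s i j).
Proof. by rewrite /expo /= mutBE eqxx /= opprK. Qed.

Let exmat' l : l != i -> exmat s' l j = exmat s l j
  + (pospart (exmat s l i) * pospart (exmat s i j) - pospart (- exmat s l i) * pospart (- exmat s i j)).
Proof. by move=> li; rewrite mutBE (negPf li) (negPf ji). Qed.

Let coeffs' : coeffs s' j = (coeffs s j * (gexpz (coeffs s i) (pospart (exmat s i j))
              * gexpz (coeffs s i ⊕ 1) (- exmat s i j)%R))%g.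
Proof. by rewrite ffunE (negPf ji) mulgA. Qed.

(* The exchange monomials at [j] after mutation at [i], compared with those
   before: their ratio is the old ratio multiplied by a power of an exchange
   monomial at [i]. This is where the rules for the coefficients and the matrix
   fit together. *)
Let key_minus : exmat s i j <= 0 -> drop i (hminus s' j) =
  (drop i (hplus s' j) * (hplus s j)^-1 * drop i (hminus s j) * gexpz (hminus s i) e)%g.
Proof.
move=> b0; have p0 : pospart (exmat s i j) = 0 by rewrite /pospart; lia.
have e_neg : e%:Z = - exmat s i j by rewrite /e; lia.
apply: gam_eq => [|l].
  rewrite !gam_coefM coef_gexpz !gam_coefV !coef_drop !coef_hplus !coef_hminus coeffs' p0 gexpz0 mul1g gexpzV.
  rewrite e_neg; exact: exchange_coef_minus.
rewrite !expoM expo_inv expo_gexpz.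
case: (eqVneq l i) => [->|li].
  by rewrite !expo_drop (expo_hminus i gs) /expo /= p0; lia.
rewrite !expo_drop_neq // /expo /= exmat' // p0 mulr0 sub0r.
have -> : pospart (- exmat s i j) = e by rewrite /pospart /e; lia.
rewrite (pospartN (_ + _)) (pospartN (exmat s l j)); ring.
Qed.

Let key_plus : 0 <= exmat s i j -> drop i (hplus s' j) =
  (drop i (hminus s' j) * (hminus s j)^-1 * drop i (hplus s j) * gexpz (hplus s i) e)%g.
Proof.
move=> b0; have p0 : pospart (- exmat s i j) = 0 by rewrite /pospart; lia.
have pe : pospart (exmat s i j) = e by rewrite /pospart /e; lia.
apply: gam_eq => [|l].
  rewrite !gam_coefM coef_gexpz !gam_coefV !coef_drop !coef_hplus !coef_hminus coeffs' pe gexpzMl gexpzV -gexpzN.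
  rewrite (_ : - exmat s i j = - e%:Z); last by rewrite /e; lia.
  exact: exchange_coef_plus.
rewrite !expoM expo_inv expo_gexpz.
case: (eqVneq l i) => [->|li].
  by rewrite !expo_drop (expo_hplus i gs) /expo /= p0; lia.
rewrite !expo_drop_neq // /expo /= exmat' // p0 mulr0 subr0.
rewrite pe (pospartN (_ + _)) (pospartN (exmat s l j)); ring.
Qed.

Hypothesis unlinked : exmat s i j = 0 -> exists2 w : P -> int,
  forall p q, w (p * q)%g = w p + w q & w (coeffs s i) = 0 /\ w (coeffs s j) <> 0.

(** The two signs of the entry [b_ij] exchange the roles of the two monomials in
    each exchange relation; either way this is the situation of [rank_two]. *)
Lemma star_exchange f :
  gen (star_gens emb (cluster s) i (cluster s' i)) f ->
  gen (star_gens emb (cluster s) j (cluster (mut emb j s) j)) f ->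
  gen (star_gens emb (cluster s') j (cluster (mut emb j s') j)) f.
Proof.
have relI := exchange_relation embP i gs; rewrite -/s' in relI.
have relJ := exchange_relation embP j gs.
have relJ' := exchange_relation embP j gs'.
have x'j : cluster s' j = cluster s j by rewrite mut_cluster_neq.
rewrite x'j !mon_mut_drop // expo_h'.1 expo_h'.2 -/s' in relJ'.
have bji : exmat s j i = - exmat s i j by rewrite (skewE skB).
set S := star_gens emb (cluster s') j _.
have SM g : expo i g = 0 -> expo j g = 0 -> gen S (mon emb (cluster s) g).
  move=> gi gj; apply: gen_in; left; exists g => //.
  rewrite mon_mut_drop // -/s' gi expr0z mulr1; congr (mon _ _ _).
  by rewrite dropE gi oppr0 gexpz0 mulg1.
have as0 : cluster s' i != 0 by exact: mut_var_neq0.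
have Sas : gen S (cluster s' i).
  by apply: gen_in; left; exists (var P i); rewrite ?(mon_var embP) // expo_var eq_sym (negPf ij).
have Sas' : gen S (cluster s' i)^-1.
  apply: gen_in; left; exists (var P i)^-1%g; first by rewrite expo_inv expo_var eq_sym (negPf ij).
  by rewrite (monV embP (proj1 gs')) (mon_var embP).
have Sb : gen S (cluster s j) by apply: gen_in; right; left.
have Sbss : gen S (cluster (mut emb j s') j) by apply: gen_in; right; right.
have [b0|b0] := leP (exmat s i j) 0.
  have pe : pospart (- exmat s i j) = e by rewrite /pospart /e; lia.
  have p0 : pospart (exmat s i j) = 0 by rewrite /pospart; lia.
  rewrite pe p0 expr0z mulr1 (key_minus b0) in relJ'.
  apply: (rank_two embP xfree ij (al := drop j (hplus s i)) (be := hminus s i)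
    (ga := drop i (hminus s j)) (de := hplus s j)
    (ka := (drop i (hplus s' j) * (hplus s j)^-1)%g) (e := e) _ _ _ _ _ _ _ _ _ _ _ _ _
    erefl erefl _ SM as0 Sas Sas' Sb Sbss).
  - by rewrite expo_drop_neq // (expo_hplus i gs).
  - by rewrite expo_drop.
  - by rewrite (expo_hminus i gs).
  - by rewrite /expo /= bji opprK.
  - by rewrite expo_drop.
  - by rewrite expo_drop_neq // (expo_hminus j gs).
  - by rewrite /expo /=.
  - by rewrite (expo_hplus j gs).
  - by rewrite expoM expo_drop expo_inv /expo /= p0.
  - by rewrite expoM expo_drop_neq // expo_inv (expo_hplus j gs') (expo_hplus j gs).
  - rewrite relI (mon_drop j (hplus s i) xfree); rewrite exprnP; congr (_ * _ ^ _ + _).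
    by rewrite /expo /= bji.
  - rewrite relJ addrC (mon_drop i (hminus s j) xfree); rewrite exprnP; congr (_ * _ ^ _ + _).
    exact: pe.
  - rewrite relJ' !(monM embP xfree) (mon_expz embP xfree) (monV embP xfree).
    have := mon_neq0 xfree (hplus s j) => h0.
    by rewrite -!exprnP; field.
  move=> e0; have {}b0 : exmat s i j = 0 by rewrite /e in e0; lia.
  have [w wM [wi wj]] := unlinked b0; exists (fun g => w g.1) => [g h|]; first exact: wM.
  rewrite !coef_drop !coef_hplus !coef_hminus !wM wi add0r; split=> // wE.
  by apply: wj; move: wE; lia.
have pe : pospart (exmat s i j) = e by rewrite /pospart /e; lia.
have p0 : pospart (- exmat s i j) = 0 by rewrite /pospart; lia.
rewrite pe p0 expr0z mulr1 (key_plus (ltW b0)) in relJ'.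
apply: (rank_two embP xfree ij (al := drop j (hminus s i)) (be := hplus s i)
    (ga := drop i (hplus s j)) (de := hminus s j)
    (ka := (drop i (hminus s' j) * (hminus s j)^-1)%g) (e := e) _ _ _ _ _ _ _ _ _ _ _ _ _
    erefl erefl _ SM as0 Sas Sas' Sb Sbss).
- by rewrite expo_drop_neq // (expo_hminus i gs).
- by rewrite expo_drop.
- by rewrite (expo_hplus i gs).
- by rewrite /expo /= bji.
- by rewrite expo_drop.
- by rewrite expo_drop_neq // (expo_hplus j gs).
- by rewrite /expo /=.
- by rewrite (expo_hminus j gs).
- by rewrite expoM expo_drop expo_inv /expo /= p0.
- by rewrite expoM expo_drop_neq // expo_inv (expo_hminus j gs') (expo_hminus j gs).
- rewrite relI addrC (mon_drop j (hminus s i) xfree); rewrite exprnP; congr (_ * _ ^ _ + _).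
  by rewrite /expo /= bji opprK.
- rewrite relJ (mon_drop i (hplus s j) xfree); rewrite exprnP; congr (_ * _ ^ _ + _).
  exact: pe.
- rewrite relJ' !(monM embP xfree) (mon_expz embP xfree) (monV embP xfree).
  have := mon_neq0 xfree (hminus s j) => h0.
  by rewrite -!exprnP; field.
by rewrite /e; lia.
Qed.
End StarExchange.
End StarRings.

(** * The Laurent phenomenon *)

Section Laurent.
Variables (m : nat) (P : semifieldType) (K : fieldType) (emb : P -> K).
Hypothesis embP : multiplicative_map emb.
Local Notation seed := (preseed m P K).
Local Notation G := (gam m P).
Implicit Types (s : seed) (i j k l : 'I_m) (g : G).

(** The coprimality hypothesis of the unlinked case, required after every word so
    that it is inherited by all seeds of the pattern. *)
Definition coef_indep s := forall ks i j, i != j -> exists2 w : P -> int,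
  forall p q, w (p * q)%g = w p + w q &
  w (coeffs (muts emb ks s) i) = 0 /\ w (coeffs (muts emb ks s) j) <> 0.

Lemma coef_indep_muts s ks : coef_indep s -> coef_indep (muts emb ks s).
Proof. by move=> indep ls; have := indep (ks ++ ls); rewrite muts_cat. Qed.

Definition upper s f :=
  forall k, gen (star_gens emb (cluster s) k (cluster (mut emb k s) k)) f.

(** In direction [k] the star ring is the same before and after mutation at [k],
    because mutation is an involution. *)
Lemma upper_mut s k f : good emb s -> coef_indep s -> upper s f -> upper (mut emb k s) f.
Proof.
move=> gs indep sf j; have [->|jk] := eqVneq j k; last first.
  apply: star_exchange => //; first by rewrite eq_sym.
  by move=> _; apply: (indep [::]); rewrite eq_sym.
rewrite mutK //; apply: gen_sub (sf k) => c [[g gk ->]|[->|->]].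
- apply: gen_in; left; exists g => //.
  by rewrite (mon_mut embP) // gk oppr0 gexpz0 mulg1 expr0z mulr1.
- by apply: gen_in; right; right.
- by apply: gen_in; right; left.
Qed.

Lemma upper_muts s ks f : good emb s -> coef_indep s -> upper s f -> upper (muts emb ks s) f.
Proof.
elim: ks s => //= k ks IH s gs indep sf; apply: IH.
- exact: good_mut.
- exact: (@coef_indep_muts s [:: k] indep).
- exact: upper_mut.
Qed.

Lemma cluster_upper s l : good emb s -> upper s (cluster s l).
Proof.
move=> gs k; apply: gen_in; have [->|lk] := eqVneq l k; first by right; left.
by left; exists (var P l); rewrite ?(mon_var embP) // expo_var eq_sym (negPf lk).
Qed.

(** A variable of the last cluster lies in the upper bound there, hence in
    the upper bound of the first cluster, which consists of Laurent
    polynomials. *)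
Theorem laurent_phenomenon s ks l : good emb s -> coef_indep s ->
  exists f, cluster (muts emb ks s) l = ev emb (cluster s) f.
Proof.
move=> gs indep; have gt := good_muts embP ks gs.
have := upper_muts (rev ks) gt (@coef_indep_muts s ks indep) (cluster_upper l gt).
rewrite muts_rev // => /(_ l) sl.
by have := star_ev embP (proj1 gs) (ev_binom embP l gs) sl.
Qed.
End Laurent.

(** * Positive elements of group rings *)

Section PositiveLists.
Variable G : semifieldType.
Implicit Types (p q : seq G) (g h : G).

(** A nonempty list of monomials stands for a Laurent polynomial with positive
    coefficients: unlike elements of the group ring, lists can also be summed in
    the semifield, by [osum] below. *)
Definition zsum p : zring G := \sum_(g <- p) gmon g.
Definition lmul p q : seq G := [seq (g * h)%g | g <- p, h <- q].

Lemma zsum_coef p g : zcoef g (zsum p) = (count_mem g p)%:Z.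
Proof.
rewrite zcoef_sum; elim: p => [|h p IH]; first by rewrite big_nil.
by rewrite big_cons IH gmon_coef /=; case: (h == g).
Qed.

Lemma zsum_supp p g : (g \in zsupp (zsum p)) = (g \in p).
Proof. by rewrite -zcoef_neq0 zsum_coef -has_pred1 has_count lt0n; lia. Qed.

Lemma zsum_neq0 p : p != [::] -> zsum p != 0.
Proof.
case: p => // g p _; apply/eqP => /(congr1 (zcoef g)).
by rewrite zcoef0 zsum_coef /= eqxx; lia.
Qed.

Lemma zsum_perm p q : (zsum p = zsum q) <-> perm_eq p q.
Proof.
split=> [pq|pq]; last exact: perm_big.
apply/allP => g _ /=; apply/eqP.
by have := congr1 (zcoef g) pq; rewrite !zsum_coef => -[].
Qed.

Lemma zsum_cat p q : zsum (p ++ q) = zsum p + zsum q.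
Proof. exact: big_cat. Qed.

Lemma zsum_mul p q : zsum (lmul p q) = zsum p * zsum q.
Proof.
rewrite /zsum big_allpairs_dep mulr_suml; apply: eq_bigr => g _.
by rewrite mulr_sumr; apply: eq_bigr => h _; rewrite gmonM.
Qed.

Lemma zsum_map_mul g p : zsum [seq (g * h)%g | h <- p] = gmon g * zsum p.
Proof. by rewrite /zsum big_map mulr_sumr; apply: eq_bigr => h _; rewrite gmonM. Qed.

Lemma lmul_neq0 p q : p != [::] -> q != [::] -> lmul p q != [::].
Proof. by case: p => // g p; case: q. Qed.

Local Open Scope group_scope.

(** Semifields have no zero: the value on the empty list is a dummy. *)
Fixpoint osum p : G := if p is g :: p' then (if p' is [::] then g else g ⊕ osum p') else 1.

Lemma osum_cons g p : p != [::] -> osum (g :: p) = g ⊕ osum p.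
Proof. by case: p. Qed.

Lemma osum_cat p q : p != [::] -> q != [::] -> osum (p ++ q) = osum p ⊕ osum q.
Proof.
elim: p => // g [|h p] IH _ q0; first by rewrite cat1s osum_cons.
by rewrite [in LHS]cat_cons osum_cons // IH // sfaddA -osum_cons.
Qed.

Lemma osum_map_mul g p : p != [::] -> osum [seq g * h | h <- p] = g * osum p.
Proof.
elim: p => // h [|k p] IH _; first by [].
by rewrite [in RHS]osum_cons // sfmulDr -IH.
Qed.

Lemma osum_mul p q : p != [::] -> q != [::] -> osum (lmul p q) = osum p * osum q.
Proof.
elim: p => // g [|h p] IH _ q0; first by rewrite /lmul /= cats0 osum_map_mul.
rewrite [in RHS]osum_cons // sfmulDl -IH // -osum_map_mul // -osum_cat //.
  by case: (q) q0.
exact: lmul_neq0.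
Qed.

Lemma osum_perm p q : perm_eq p q -> osum p = osum q.
Proof.
move=> pq; apply: (catCA_perm_ind (P := fun s => osum p = osum s)) pq erefl.
move=> s1 s2 s3 ->.
have catC s t : osum (s ++ t) = osum (t ++ s).
  have [->|s0] := eqVneq s [::]; first by rewrite cats0.
  have [->|t0] := eqVneq t [::]; first by rewrite cats0.
  by rewrite !osum_cat // sfaddC.
rewrite !catA; have [->|s30] := eqVneq s3 [::]; first by rewrite !cats0.
have [E|s120] := eqVneq (s1 ++ s2) [::].
  have [-> ->] // : s1 = [::] /\ s2 = [::] by move: E; case: (s1) => // /= ->.
rewrite (osum_cat s120 s30) (catC s1) -osum_cat //.
by move: s120; case: (s1) (s2) => [|? ?] [|? ?].
Qed.
End PositiveLists.

Lemma map_lmul (G H : semifieldType) (phi : G -> H) (p q : seq G) :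
  {morph phi : g h / (g * h)%g >-> (g * h)%g} ->
  [seq phi g | g <- lmul p q] = lmul (map phi p) (map phi q).
Proof.
move=> phiM; rewrite /lmul map_allpairs allpairs_mapl allpairs_mapr.
by apply: eq_allpairs => g h; exact: phiM.
Qed.

(** The single coefficient of a factor of a monomial is an invertible integer. *)
Lemma unit_monomial (G : semifieldType) (f g : zring G) c : f * g = gmon c ->
  exists a, f = gmon a \/ f = - gmon a.
Proof.
move=> fg; have [a fa] := unit_supp fg; exists a.
have fE : f = gmon a *~ zcoef a f.
  apply: groupringP => k; rewrite zcoefMz gmon_coef; case: eqP => [<-|ak]; first by rewrite intz.
  by rewrite mul0rz; apply/eqP; rewrite zcoef_eq0; apply/negP => /fa /esym.
have z1 : zcoef (a^-1 * c)%g g * zcoef a f = 1.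
  by have := congr1 (zcoef c) fg; rewrite {1}fE mulrzAl zcoefMz gmon_mul_coef gmon_coef eqxx mulrzz.
have : (absz (zcoef (a^-1 * c)%g g) * absz (zcoef a f) == 1)%N by rewrite -abszM z1.
rewrite muln_eq1 => /andP [_ /eqP z2]; rewrite fE.
have [->|->] : zcoef a f = 1 \/ zcoef a f = -1 by lia.
  by left; rewrite mulr1z.
by right; rewrite mulrN1z.
Qed.

(** * Subtraction-free expressions over two semifields *)

Section CoRepresentation.
Variables (m : nat) (P1 P2 : semifieldType) (phi : P1 -> P2).
Hypothesis (phiM : {morph phi : p q / (p * q)%g >-> (p * q)%g}).
Hypothesis (phiD : {morph phi : p q / (p ⊕ q)%g >-> (p ⊕ q)%g}).
Variables (K1 K2 : fieldType) (emb1 : P1 -> K1) (emb2 : P2 -> K2).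
Hypotheses (emb1P : multiplicative_map emb1) (emb2P : multiplicative_map emb2).
Local Notation G1 := (gam m P1).
Local Notation G2 := (gam m P2).

Definition phiG (g : G1) : G2 := (phi g.1, g.2).

Lemma phiGM : {morph phiG : g h / (g * h)%g >-> (g * h)%g}.
Proof. by move=> g h; congr (_, _); exact: phiM. Qed.

Lemma expo_phiG i g : expo i (phiG g) = expo i g. Proof. by []. Qed.

Lemma phiG_var i : phiG (var P1 i) = var P2 i.
Proof. by congr (_, _); exact: (hom1 phiM). Qed.

Section Base.
Variables (x1 : {ffun 'I_m -> K1}) (x2 : {ffun 'I_m -> K2}).
Hypotheses (x1free : alg_free emb1 x1) (x2free : alg_free emb2 x2).

(** [X1], [X2] and [c] are the values of one subtraction-free expression in the
    cluster [x1], in [x2] after applying [phi], and in the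
    semifield [P1] with all variables set to 1. *)
Definition corep (X1 : K1) (X2 : K2) (c : P1) := exists p q : seq G1,
  [/\ p != [::] /\ q != [::],
      X1 = ev emb1 x1 (zsum p) / ev emb1 x1 (zsum q),
      X2 = ev emb2 x2 (zsum (map phiG p)) / ev emb2 x2 (zsum (map phiG q)) &
      c = (osum [seq g.1 | g <- p] / osum [seq g.1 | g <- q])%g].

Lemma ev_zsum_neq0 (P : semifieldType) (K : fieldType) (emb : P -> K)
    (x : {ffun 'I_m -> K}) (p : seq (gam m P)) :
  alg_free emb x -> p != [::] -> ev emb x (zsum p) != 0.
Proof.
move=> xfree /zsum_neq0; apply: contraNneq => p0.
by apply/eqP/xfree; rewrite p0 ev0.
Qed.

Lemma phiG_neq0 (p : seq G1) : p != [::] -> map phiG p != [::].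
Proof. by case: p. Qed.

Lemma fst_neq0 (p : seq G1) : p != [::] -> [seq g.1 | g <- p] != [::].
Proof. by case: p. Qed.

Lemma osum_fst_mul (p q : seq G1) : p != [::] -> q != [::] ->
  osum [seq g.1 | g <- lmul p q] = (osum [seq g.1 | g <- p] * osum [seq g.1 | g <- q])%g.
Proof.
move=> p0 q0; rewrite (@map_lmul G1 P1 (fun g => g.1)) //.
by rewrite osum_mul ?fst_neq0.
Qed.

Lemma corep_mon g : corep (mon emb1 x1 g) (mon emb2 x2 (phiG g)) g.1.
Proof.
exists [:: g], [:: 1%g]; split=> //=.
- by rewrite /zsum !big_seq1 !ev_gmon (mon1 emb1P) divr1.
- rewrite /zsum !big_seq1 !ev_gmon (_ : phiG 1%g = 1%g) ?(mon1 emb2P) ?divr1 //.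
  exact: (hom1 phiGM).
- by rewrite invg1 mulg1.
Qed.

Lemma corepM X1 X2 c Y1 Y2 d : corep X1 X2 c -> corep Y1 Y2 d ->
  corep (X1 * Y1) (X2 * Y2) (c * d)%g.
Proof.
move=> [p [q [[p0 q0] -> -> ->]]] [p' [q' [[p'0 q'0] -> -> ->]]].
exists (lmul p p'), (lmul q q'); split; first by split; apply: lmul_neq0.
- by rewrite !zsum_mul !(evM emb1P x1free) invfM mulrACA.
- by rewrite !(map_lmul _ _ phiGM) !zsum_mul !(evM emb2P x2free) invfM mulrACA.
- by rewrite !osum_fst_mul // invgM (sfmulC (_^-1)%g) sfmulACA.
Qed.

Lemma corepV X1 X2 c : corep X1 X2 c -> corep X1^-1 X2^-1 c^-1%g.
Proof.
move=> [p [q [[p0 q0] -> -> ->]]]; exists q, p; split=> //; rewrite ?invf_div //.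
by rewrite invgF.
Qed.

Lemma corepD X1 X2 c Y1 Y2 d : corep X1 X2 c -> corep Y1 Y2 d ->
  corep (X1 + Y1) (X2 + Y2) (c ⊕ d)%g.
Proof.
move=> [p [q [[p0 q0] -> -> ->]]] [p' [q' [[p'0 q'0] -> -> ->]]].
have pq'0 : lmul p q' != [::] by exact: lmul_neq0.
have p'q0 : lmul p' q != [::] by exact: lmul_neq0.
exists (lmul p q' ++ lmul p' q), (lmul q q'); split.
- by split; [case: (lmul p q') pq'0 | exact: lmul_neq0].
- rewrite zsum_cat !zsum_mul (evD emb1 x1) !(evM emb1P x1free) addf_div ?ev_zsum_neq0 //.
- rewrite map_cat zsum_cat !(map_lmul _ _ phiGM) !zsum_mul (evD emb2 x2) !(evM emb2P x2free).
  by rewrite addf_div ?ev_zsum_neq0 ?phiG_neq0.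
- rewrite map_cat osum_cat ?fst_neq0 // !osum_fst_mul //.
  set a := osum _; set b := osum _; set a' := osum _; set b' := osum _.
  rewrite sfmulDl; congr (_ ⊕ _)%g.
    by rewrite invgM (sfmulC b'^-1%g) sfmulACA mulgV mulg1.
  by rewrite invgM sfmulACA mulgV mulg1.
Qed.

Lemma corep1 : corep 1 1 1%g.
Proof.
have := corep_mon 1%g; rewrite (mon1 emb1P) (_ : phiG 1%g = 1%g) ?(mon1 emb2P) //.
exact: (hom1 phiGM).
Qed.

Lemma corepX X1 X2 (n : nat) : corep X1 X2 1%g -> corep (X1 ^+ n) (X2 ^+ n) 1%g.
Proof.
move=> X12; elim: n => [|n IH]; first by rewrite !expr0; exact: corep1.
by rewrite !exprS -(mulg1 1%g); exact: corepM.
Qed.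

Lemma corep_expz X1 X2 (z : int) : corep X1 X2 1%g -> corep (X1 ^ z) (X2 ^ z) 1%g.
Proof.
case: z => n X12; first exact: corepX.
by rewrite -invg1; apply/corepV/corepX.
Qed.

Lemma corep_prod (X1 : 'I_m -> K1) (X2 : 'I_m -> K2) :
  (forall i, corep (X1 i) (X2 i) 1%g) -> corep (\prod_i X1 i) (\prod_i X2 i) 1%g.
Proof.
move=> X12; apply: (big_ind2 (fun a b => corep a b 1%g)) => //; first exact: corep1.
by move=> a b c d ac bd; rewrite -(mulg1 1%g); exact: corepM.
Qed.

Lemma corep_emb p : corep (emb1 p) (emb2 (phi p)) p.
Proof.
have := corep_mon (cst m p); rewrite (mon_cst emb1).
by rewrite (_ : phiG (cst m p) = cst m (phi p)) ?(mon_cst emb2).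
Qed.

(** The factor [y_k ⊕ 1] of the exchange relation is what makes the new
    variable evaluate to 1 in the semifield. *)
Lemma corep_mut (s1 : preseed m P1 K1) (s2 : preseed m P2 K2) k :
  coeffs s2 = [ffun i => phi (coeffs s1 i)] -> exmat s2 = exmat s1 ->
  (forall i, corep (cluster s1 i) (cluster s2 i) 1%g) ->
  forall i, corep (cluster (mut emb1 k s1) i) (cluster (mut emb2 k s2) i) 1%g.
Proof.
move=> yE BE rep i; rewrite !ffunE; case: ifP => // _; rewrite BE yE ffunE.
rewrite [X in corep _ _ X](_ : 1 = (coeffs s1 k * 1 ⊕ 1) * ((coeffs s1 k ⊕ 1) * 1)^-1)%g;
  last by rewrite !mulg1 mulgV.
apply: corepM; last first.
  apply/corepV/corepM => //.
  by have := corep_emb (coeffs s1 k ⊕ 1)%g; rewrite phiD (hom1 phiM).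
apply: corepD; last by apply: corep_prod => j; exact: corep_expz.
apply: corepM; first exact: corep_emb.
by apply: corep_prod => j; exact: corep_expz.
Qed.

(** An identity between an expression [p / q] and a monomial [g] says that the
    list [p] is a rearrangement of [g * q]: coefficients in the group ring are
    multiplicities, so nothing cancels. Rearrangements are respected by
    [phi] and by the sum of the semifield. *)
Lemma corep_transfer X1 X2 c g : corep X1 X2 c -> X1 = mon emb1 x1 g ->
  X2 = mon emb2 x2 (phiG g) /\ c = g.1.
Proof.
move=> [p [q [[p0 q0] -> -> ->]]] E.
have pE : perm_eq p [seq (g * h)%g | h <- q].
  apply/zsum_perm; rewrite zsum_map_mul; apply: x1free.
  by rewrite (evM emb1P x1free) ev_gmon -E divfK ?ev_zsum_neq0.
split.
  rewrite (proj2 (zsum_perm _ _) (perm_map phiG pE)) -map_comp.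
  rewrite (eq_map (g := (fun h => (phiG g * phiG h)%g))); last by move=> h; exact: phiGM.
  rewrite (map_comp (fun h => (phiG g * h)%g)) zsum_map_mul (evM emb2P x2free) ev_gmon.
  by rewrite mulfK ?ev_zsum_neq0 ?phiG_neq0.
rewrite (osum_perm (perm_map (fun g => g.1) pE)) -map_comp /=.
rewrite (eq_map (g := (fun h => (g.1 * h.1)%g))) //.
by rewrite (map_comp (fun h => (g.1 * h)%g)) osum_map_mul ?fst_neq0 // mulgK.
Qed.
End Base.
End CoRepresentation.

(** * Descending periods and lifting clusters *)

Section Lifting.
Variables (m : nat) (P1 P2 : semifieldType) (phi : P1 -> P2).
Hypothesis (phiM : {morph phi : p q / (p * q)%g >-> (p * q)%g}).
Hypothesis (phiD : {morph phi : p q / (p ⊕ q)%g >-> (p ⊕ q)%g}).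
Variables (K1 K2 : fieldType) (emb1 : P1 -> K1) (emb2 : P2 -> K2).
Hypotheses (emb1P : multiplicative_map emb1) (emb2P : multiplicative_map emb2).
Local Notation G1 := (gam m P1).
Local Notation G2 := (gam m P2).
Local Notation seed1 := (preseed m P1 K1).
Local Notation seed2 := (preseed m P2 K2).
Implicit Types (s : seed1) (t : seed2) (sg : 'S_m).

(** Clusters are left out: those of paired seeds are tied by [corep]. *)
Definition paired s t :=
  coeffs t = [ffun i => phi (coeffs s i)] /\ exmat t = exmat s.

Lemma paired_mut s t k : paired s t -> paired (mut emb1 k s) (mut emb2 k t).
Proof.
move=> [yE BE]; split; last by rewrite /= BE.
by rewrite /= BE yE hom_mutY.
Qed.

Lemma paired_muts s t ks : paired s t -> paired (muts emb1 ks s) (muts emb2 ks t).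
Proof. by elim: ks s t => //= k ks IH s t st; apply/IH/paired_mut. Qed.

Lemma corep_muts s t ks i : good emb1 s -> good emb2 t -> paired s t ->
  corep phi emb1 emb2 (cluster s) (cluster t)
    (cluster (muts emb1 ks s) i) (cluster (muts emb2 ks t) i) 1%g.
Proof.
move=> [sfree _] [tfree _] st.
suff H s' t' : paired s' t' -> (forall i, corep phi emb1 emb2 (cluster s) (cluster t)
      (cluster s' i) (cluster t' i) 1%g) ->
    forall i, corep phi emb1 emb2 (cluster s) (cluster t)
      (cluster (muts emb1 ks s') i) (cluster (muts emb2 ks t') i) 1%g.
  apply: H => // j.
  have := corep_mon phiM emb1P emb2P (cluster s) (cluster t) (var P1 j).
  by rewrite (phiG_var phiM) (mon_var emb1P) (mon_var emb2P).
elim: ks s' t' => //= k ks IH s' t' st' rep; apply: IH; first exact: paired_mut.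
by case: st' => yE BE; apply: corep_mut.
Qed.

(** The matrices and coefficients of the two patterns correspond at each step, so
    only the clusters have to be compared, and there the period is an identity
    between positive expressions. *)
Lemma descend_period s t ks sg : good emb1 s -> good emb2 t -> paired s t ->
  muts emb1 ks s = renumber sg s -> muts emb2 ks t = renumber sg t.
Proof.
move=> gs gt st E; have [yE BE] := paired_muts ks st; have [yE0 BE0] := st.
have tE : cluster (muts emb2 ks t) = cluster (renumber sg t).
  apply/ffunP => i; rewrite ffunE.
  have rep := corep_muts ks i gs gt st.
  have [|-> _] := corep_transfer phiM emb1P emb2P (proj1 gs) (proj1 gt) rep (g := var P1 (sg i)).
    by rewrite (mon_var emb1P) E ffunE.
  by rewrite (phiG_var phiM) (mon_var emb2P).
rewrite E in yE BE; move: tE yE BE; case: (muts emb2 ks t) => X y B /= -> -> ->.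
congr Preseed; first by apply/ffunP => i; rewrite !ffunE yE0 ffunE.
by rewrite BE0.
Qed.

(** With positive coefficients no monomial of numerator or denominator is lost
    under [phi], so the top and bottom degrees in each variable can
    be read after applying [phi]. *)
Lemma lift_monomial s t ks l h : good emb1 s -> good emb2 t -> paired s t ->
    cluster (muts emb2 ks t) l = mon emb2 (cluster t) h ->
  forall f, cluster (muts emb1 ks s) l = ev emb1 (cluster s) f ->
  forall g i, g \in zsupp f -> expo i g = expo i h.
Proof.
move=> gs gt st tE f fE g i gf; have [sfree _] := gs; have [tfree _] := gt.
have [p [q [[p0 q0] X1E X2E _]]] := corep_muts ks l gs gt st.
have E1 : zsum p = f * zsum q.
  by apply: (sfree); rewrite (evM emb1P sfree) -fE X1E divfK ?(ev_zsum_neq0 sfree).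
have E2 : perm_eq (map (phiG phi) p) [seq (h * g)%g | g <- map (phiG phi) q].
  apply/zsum_perm; rewrite zsum_map_mul; apply: (tfree).
  by rewrite (evM emb2P tfree) ev_gmon -tE X2E divfK // (ev_zsum_neq0 tfree) // phiG_neq0.
have f0 : f != 0.
  by apply: contraNneq (zsum_neq0 p0) => f0; rewrite E1 f0 mul0r.
(* The top weight of [f] plus that of [q] is reached in [p], and [p] is sent by
   [phi] onto [h] times the image of [q]. *)
have bound (w : G1 -> int) (w' : G2 -> int) : (forall g, w' (phiG phi g) = w g) ->
    (forall a b, w (a * b)%g = w a + w b) -> (forall a b, w' (a * b)%g = w' a + w' b) ->
    forall a, a \in zsupp f -> w a <= w' h.
  move=> ww' wM w'M a af.
  have [a0 [b0 [a0f b0q abp amax bmax]]] := top_weight wM f0 (zsum_neq0 q0).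
  apply: le_trans (amax a af) _.
  have : phiG phi (a0 * b0)%g \in map (phiG phi) p by rewrite map_f // -zsum_supp E1.
  rewrite (perm_mem E2) => /mapP [_ /mapP [c cq ->] E].
  have := congr1 w' E; rewrite w'M !ww' wM.
  by have := bmax c; rewrite zsum_supp => /(_ cq); lia.
apply/le_anti/andP; split.
  by apply: (bound (expo i) (expo i)) => // [a b|a b]; exact: expoM.
rewrite -lerN2.
by apply: (bound (fun g => - expo i g) (fun g => - expo i g)) => // [a b|a b]; rewrite expoM opprD.
Qed.

(** The exponents in [f] being known, [f] is [x_(sg l)] times an element [h] of
    the group ring of [P1], whose value does not depend on the cluster. Since
    [x_(sg l)] is a Laurent polynomial in the last cluster, [h] divides a
    monomial there, hence is plus or minus a group element [a]. A negative sign
    is excluded by positivity of [p] and [q], and [a = 1] since cluster variables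
    evaluate to 1 in the semifield. *)
Lemma lift_cluster s t ks sg : good emb1 s -> good emb2 t -> paired s t ->
    coef_indep emb1 s ->
    (forall l, cluster (muts emb2 ks t) l = cluster t (sg l)) ->
  forall l, cluster (muts emb1 ks s) l = cluster s (sg l).
Proof.
move=> gs gt st indep tE l; have [sfree _] := gs.
pose s' := muts emb1 ks s; have gs' : good emb1 s' by exact: good_muts.
have [s'free _] := gs'.
have [f fE] := laurent_phenomenon emb1P ks l gs indep.
have [psi psiE] : exists f, cluster s (sg l) = ev emb1 (cluster s') f.
  have := laurent_phenomenon emb1P (rev ks) (sg l) gs' (@coef_indep_muts _ _ _ _ _ ks indep).
  by rewrite /s' muts_rev.
have fsupp g i : g \in zsupp f -> expo i g = expo i (var P2 (sg l)).
  by apply: (lift_monomial gs gt st _ fE); rewrite tE (mon_var emb2P).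
pose h := f * gmon (var P1 (sg l))^-1%g.
have fh : f = gmon (var P1 (sg l)) * h.
  by rewrite /h mulrCA -gmonM mulgV gmon1 mulr1.
have hE : ev emb1 (cluster s) h = ev emb1 (cluster s') h.
  have hsupp g : g \in zsupp h -> g = cst m g.1.
    rewrite /h mulrC -zcoef_neq0 gmon_mul_coef invgK zcoef_neq0 => gf.
    apply: gam_eq => // i; have := fsupp _ i gf; rewrite expoM !expo_var expo_cst; lia.
  apply: (@groupring_ind _ (fun h => ev emb1 (cluster s) h = ev emb1 (cluster s') h)).
  - by rewrite !ev0.
  - by move=> u v uE vE; rewrite !evB uE vE.
  - by move=> g /hsupp ->; rewrite !ev_gmon !(mon_cst emb1).
have unit_h : h * psi = gmon (var P1 l).
  apply: (s'free); rewrite (evM emb1P s'free) ev_gmon (mon_var emb1P) -hE -psiE.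
  by rewrite /s' fE fh (evM emb1P sfree) ev_gmon (mon_var emb1P) mulrC.
have [p [q [[p0 q0] X1E _ _]]] := corep_muts ks l gs gt st.
have E1 : zsum p = f * zsum q.
  by apply: (sfree); rewrite (evM emb1P sfree) -fE X1E divfK ?(ev_zsum_neq0 sfree).
have [a ha] := unit_monomial unit_h.
have {ha} fa : f = gmon (var P1 (sg l) * a)%g.
  case: ha fh => -> fh; first by rewrite fh gmonM.
  case: q q0 E1 {X1E} => // c q _ E1.
  have := congr1 (zcoef ((var P1 (sg l) * a) * c)%g) E1.
  by rewrite fh mulrN -gmonM mulNr zcoefN gmon_mul_coef mulKg !zsum_coef /= eqxx; lia.
have XE : cluster (muts emb1 ks s) l = mon emb1 (cluster s) (var P1 (sg l) * a)%g.
  by rewrite fE fa ev_gmon.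
have [X2E g1] := corep_transfer phiM emb1P emb2P sfree (proj1 gt) (corep_muts ks l gs gt st) XE.
have gE : phiG phi (var P1 (sg l) * a)%g = var P2 (sg l).
  by apply: (mon_inj (proj1 gt)); rewrite -X2E tE (mon_var emb2P).
rewrite XE -[RHS](mon_var emb1P); congr (mon _ _ _); apply: gam_eq; first by rewrite -g1.
by move=> i; rewrite -(expo_phiG phi) gE.
Qed.
End Lifting.

(** * Lifting coefficients *)

Section Isolated.
Variables (m : nat) (P : semifieldType) (K : fieldType) (emb : P -> K).
Hypothesis embP : multiplicative_map emb.
Local Notation seed := (preseed m P K).
Implicit Types (s : seed) (i j k l : 'I_m).

Definition isolated k s := forall l, exmat s l k = 0.

Lemma isolated_mut k j s : good emb s -> isolated k s -> isolated k (mut emb j s).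
Proof.
move=> [_ skB] iso l; rewrite mutBE iso; case: ifP => _; first by rewrite oppr0.
by rewrite iso oppr0 !mulr0.
Qed.

Lemma isolated_muts k ks s : good emb s -> isolated k s -> isolated k (muts emb ks s).
Proof.
by elim: ks s => //= j ks IH s gs iso; apply: IH; [exact: good_mut | exact: isolated_mut].
Qed.

Lemma isolated_mutE k s : isolated k s -> cluster (mut emb k s) k
  = (emb (coeffs s k) + 1) / (emb (coeffs s k ⊕ 1)%g * cluster s k).
Proof.
move=> iso; rewrite ffunE eqxx !big1 ?mulr1 // => i _; rewrite iso ?oppr0 expr0z //.
Qed.

Definition local_data s k := (cluster s k, coeffs s k).

Lemma isolated_mut_neq k j s : isolated k s -> j != k ->
  local_data (mut emb j s) k = local_data s k.
Proof.
move=> iso jk; congr (_, _); first by rewrite mut_cluster_neq // eq_sym.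
by rewrite ffunE eq_sym (negPf jk) iso oppr0 !gexpz0 !mulg1.
Qed.

Lemma isolated_mut_local k s s' : isolated k s -> isolated k s' ->
  local_data s k = local_data s' k -> local_data (mut emb k s) k = local_data (mut emb k s') k.
Proof.
move=> iso iso' [xE yE]; congr (_, _); last by rewrite !ffunE eqxx yE.
by rewrite !isolated_mutE // xE yE.
Qed.

(** Mutations elsewhere do not touch an isolated vertex and mutation at it is an
    involution, so that it alternates between two states. *)
Lemma isolated_orbit k ks s : good emb s -> isolated k s ->
  local_data (muts emb ks s) k = local_data s k \/
  local_data (muts emb ks s) k = local_data (mut emb k s) k.
Proof.
elim: ks s => /= [|j ks IH] s gs iso; first by left.
have gs' := good_mut embP j gs; have iso' : isolated k (mut emb j s) by exact: isolated_mut.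
have [jk|jk] := eqVneq j k.
  by case: (IH _ gs' iso') => ->; [right | left]; rewrite jk ?mutK.
case: (IH _ gs' iso') => ->; [left | right]; first exact: isolated_mut_neq.
by apply: isolated_mut_local => //; exact: isolated_mut_neq.
Qed.
End Isolated.

Lemma gmon_pair (G : semifieldType) (a b c d : G) :
  gmon a + gmon b = gmon c + gmon d -> b <> c -> a = c.
Proof.
move=> E bc; apply/eqP; have := congr1 (zcoef c) E; rewrite !zcoefD !gmon_coef eqxx.
by case: (a == c) => //; case: (b =P c) => //; case: (d == c).
Qed.

Section Lift.
Variables (m : nat) (P1 P2 : semifieldType) (phi : P1 -> P2).
Hypothesis (phiM : {morph phi : p q / (p * q)%g >-> (p * q)%g}).
Hypothesis (phiD : {morph phi : p q / (p ⊕ q)%g >-> (p ⊕ q)%g}).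
Variables (K1 K2 : fieldType) (emb1 : P1 -> K1) (emb2 : P2 -> K2).
Hypotheses (emb1P : multiplicative_map emb1) (emb2P : multiplicative_map emb2).
Local Notation seed1 := (preseed m P1 K1).
Local Notation seed2 := (preseed m P2 K2).
Implicit Types (s : seed1) (t : seed2) (sg : 'S_m).

(** The monomial [g] of a cluster renumbered by [sg], in terms of the
    original cluster. *)
Definition permute sg (g : gam m P1) : gam m P1 := (g.1, fun l => g.2 ((sg^-1)%g l)).

Lemma mon_permute sg (x x' : {ffun 'I_m -> K1}) g : (forall l, x' l = x (sg l)) ->
  mon emb1 x' g = mon emb1 x (permute sg g).
Proof.
move=> xE; rewrite /mon; congr (_ * _); rewrite [RHS](reindex_inj (@perm_inj _ sg)) /=.
by apply: eq_bigr => i _; rewrite xE permK.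
Qed.

(** The variables at [k] on both sides of the period and their mutations agree, so
    the exchange relations do; the ratio of the coefficients of their
    two monomials is the coefficient of the seed. *)
Lemma lift_coeff s t ks sg k : good emb1 s -> good emb2 t -> paired phi s t ->
    coef_indep emb1 s -> muts emb2 ks t = renumber sg t ->
  coeffs (muts emb1 ks s) k = coeffs s (sg k).
Proof.
move=> gs gt st indep tE; have [sfree _] := gs.
set s' := muts emb1 ks s; have gs' : good emb1 s' by exact: good_muts.
have XE l : cluster s' l = cluster s (sg l).
  by apply: (lift_cluster phiM phiD emb1P emb2P gs gt st indep) => i; rewrite tE ffunE.
have BE i j : exmat s' i j = exmat s (sg i) (sg j).
  by have [_ <-] := paired_muts phiM phiD emb1 emb2 ks st; rewrite tE mxE (proj2 st).
(* When column [sg k] vanishes, the two exchange monomials have the same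
   exponents and cannot be told apart; use that [k] has only two states. *)
have [iso|] := boolP [forall l, exmat s l (sg k) == 0].
  have iso' : isolated k s' by move=> l; rewrite BE; exact/eqP/(forallP iso).
  have isos : isolated k s.
    by rewrite -(muts_rev emb1P ks gs); apply: isolated_muts.
  case: (isolated_orbit emb1P ks gs isos) => -[xE yE]; rewrite -/s' in xE yE.
    have -> : sg k = k; last by [].
    have : var P1 (sg k) = var P1 k.
      by apply: (mon_inj sfree); rewrite !(mon_var emb1P) -XE.
    move=> /(congr1 (expo k)); rewrite !expo_var eqxx eq_sym; by case: eqP.
  have := exchange_relation emb1P k gs; rewrite -xE XE.
  rewrite -!(mon_var emb1P (cluster s)) -(monM emb1P sfree) -!ev_gmon -evD => /sfree E.
  have := congr1 (zcoef (hplus s k)) E; rewrite zcoefD !gmon_coef eqxx.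
  case: eqP => [E'|_]; last by case: (_ == _).
  have := congr1 (expo k) E'; rewrite (expo_hplus k gs) expoM !expo_var eqxx.
  by case: (k == sg k).
rewrite negb_forall => /existsP [l0 Bl0].
(* The conjugate by [sg k] of the period at [t] is a period at the mutated
   seed. *)
have conj : cluster (mut emb1 k s') k = cluster (mut emb1 (sg k) s) (sg k).
  pose path := sg k :: ks ++ [:: k].
  have tE' : muts emb2 path (mut emb2 (sg k) t) = renumber sg (mut emb2 (sg k) t).
    transitivity (muts emb2 (ks ++ [:: k]) (mut emb2 (sg k) (mut emb2 (sg k) t))) => //.
    by rewrite mutK // muts_cat tE; exact: mut_renumber.
  have sE' : muts emb1 path (mut emb1 (sg k) s) = mut emb1 k s'.
    transitivity (muts emb1 (ks ++ [:: k]) (mut emb1 (sg k) (mut emb1 (sg k) s))) => //.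
    by rewrite mutK // muts_cat.
  rewrite -sE'; apply: (lift_cluster phiM phiD emb1P emb2P (t := mut emb2 (sg k) t)).
  - exact: good_mut.
  - exact: good_mut.
  - exact: paired_mut.
  - exact: (@coef_indep_muts _ _ _ _ s [:: sg k] indep).
  - by move=> l; rewrite tE' ffunE.
have := exchange_relation emb1P k gs'; rewrite XE conj (exchange_relation emb1P (sg k) gs).
rewrite !(mon_permute _ XE) -!ev_gmon -!evD => /sfree E.
have ep i : expo i (permute sg (hplus s' k)) = expo i (hplus s (sg k)).
  by rewrite /expo /= BE permKV.
have em i : expo i (permute sg (hminus s' k)) = expo i (hminus s (sg k)).
  by rewrite /expo /= BE permKV.
(* Exponents at [l0] tell which monomial on one side matches which on the
   other. *)
have neq : expo l0 (hplus s (sg k)) <> expo l0 (hminus s (sg k)).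
  by rewrite /expo /= /pospart; lia.
have Ep : hplus s (sg k) = permute sg (hplus s' k).
  by apply: gmon_pair E _ => E'; apply: neq; rewrite E' ep.
have Em : hminus s (sg k) = permute sg (hminus s' k).
  rewrite addrC [RHS]addrC in E; apply: gmon_pair E _ => E'; apply: neq.
  by rewrite E' em.
have /(congr1 fst) /= Ep1 := Ep; have /(congr1 fst) /= /(congr1 monoid.inv) := Em.
rewrite !invgK => Em1; move: Ep1; rewrite Em1 => /mulIg; by [].
Qed.

Theorem lift_period s t ks sg : good emb1 s -> good emb2 t -> paired phi s t ->
    coef_indep emb1 s -> muts emb2 ks t = renumber sg t ->
  muts emb1 ks s = renumber sg s.
Proof.
move=> gs gt st indep tE.
have XE l : cluster (muts emb1 ks s) l = cluster s (sg l).
  by apply: (lift_cluster phiM phiD emb1P emb2P gs gt st indep) => i; rewrite tE ffunE.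
have YE k := lift_coeff k gs gt st indep tE.
have BE i j : exmat (muts emb1 ks s) i j = exmat s (sg i) (sg j).
  by have [_ <-] := paired_muts phiM phiD emb1 emb2 ks st; rewrite tE mxE (proj2 st).
move: XE YE BE; case: (muts emb1 ks s) => X Y B /= XE YE BE; congr Preseed.
- by apply/ffunP => l; rewrite ffunE XE.
- by apply/ffunP => l; rewrite ffunE YE.
- by apply/matrixP => i j; rewrite mxE BE.
Qed.
End Lift.

(** * Tropical covers and standard seeds *)

Section YPatterns.
Variable m : nat.
Implicit Types (B : 'M[int]_m) (k : 'I_m).

Fixpoint mutsY (P : semifieldType) (ks : seq 'I_m) B (y : {ffun 'I_m -> P}) :=
  if ks is k :: ks' then mutsY ks' (mutB k B) (mutY k B y) else y.

(** Mutation of coefficients is involutive, so one can run it backwards. *)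
Lemma mutsY_surj (P : semifieldType) ks B (z : {ffun 'I_m -> P}) : B^T = - B ->
  exists y, mutsY ks B y = z.
Proof.
elim: ks B => [|k ks IH] B skB /=; first by exists z.
have [y yE] := IH _ (mutB_skew k skB); exists (mutY k (mutB k B) y).
by rewrite -{2}(mutBK k skB) mutYK.
Qed.

Lemma mutsY_hom (P Q : semifieldType) (phi : P -> Q)
    (phiM : {morph phi : p q / (p * q)%g >-> (p * q)%g})
    (phiD : {morph phi : p q / (p ⊕ q)%g >-> (p ⊕ q)%g}) ks B (y : {ffun 'I_m -> P}) :
  [ffun i => phi (mutsY ks B y i)] = mutsY ks B [ffun i => phi (y i)].
Proof. by elim: ks B y => //= k ks IH B y; rewrite IH hom_mutY. Qed.

Lemma coeffs_muts (P : semifieldType) (K : fieldType) (emb : P -> K) ks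
    (s : preseed m P K) : coeffs (muts emb ks s) = mutsY ks (exmat s) (coeffs s).
Proof. by elim: ks s => //= k ks IH s; rewrite IH. Qed.
End YPatterns.

Section Cover.
Variables (m : nat) (Q : semifieldType) (y : {ffun 'I_m -> Q}) (B : 'M[int]_m).
Hypothesis skB : B^T = - B.

(** Tropical functions of [m] free integer parameters: evaluation at a point
    [tau] is a homomorphism to the integers with minimum, for which the initial
    coefficients take the values [tau i]. All tropical initial data are thus
    images of a single one. *)
Definition tcover : semifieldType :=
  [the semifieldType of (Q * trop {ffun 'I_m -> int})%type].

Definition tcover_coeffs : {ffun 'I_m -> tcover} :=
  [ffun i => (y i, fun tau : {ffun 'I_m -> int} => tau i)].

(** Run a tropical pattern backwards from coefficients that are 0 at [i] and 1 at
    [j]; its initial values are a point [tau] at which to evaluate. *)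
Lemma tcover_indep (K : fieldType) (emb : tcover -> K) x :
  coef_indep emb (Preseed x tcover_coeffs B).
Proof.
move=> ks i j ij.
have [t tE] := mutsY_surj ks [ffun l => (fun _ : unit => (l == j)%:Z) : trop unit] skB.
pose tau : {ffun 'I_m -> int} := [ffun l => t l tt].
pose ev_tau (p : tcover) : trop unit := fun _ => p.2 tau.
have evM : {morph ev_tau : p q / (p * q)%g >-> (p * q)%g} by [].
have evD : {morph ev_tau : p q / (p ⊕ q)%g >-> (p ⊕ q)%g} by [].
have t0 : [ffun l => ev_tau (tcover_coeffs l)] = t.
  by apply/ffunP => l; rewrite !ffunE; apply: boolp.funext => -[]; rewrite /ev_tau /= ffunE.
have wE l : (mutsY ks B tcover_coeffs l).2 tau = (l == j)%:Z.
  have /ffunP/(_ l) := mutsY_hom evM evD ks B tcover_coeffs.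
  by rewrite t0 tE !ffunE => /(congr1 (fun u : trop unit => u tt)).
exists (fun p => p.2 tau) => //.
by rewrite !coeffs_muts /= !wE eqxx (negPf ij).
Qed.
End Cover.

Section StandardSeed.
Variables (m : nat) (P : semifieldType).
Local Notation G := (gam m P).

(** A field for the seed whose cluster consists of the variables of the Laurent polynomial
    ring itself, so that independence is the injectivity of the embedding into
    the fraction field. *)
Definition std_field : fieldType := {fraction zring G}.
Definition std_emb (p : P) : std_field := tofrac (gmon (cst m p)).
Definition std_cluster : {ffun 'I_m -> std_field} := [ffun i => tofrac (gmon (var P i))].

Lemma std_embP : multiplicative_map std_emb.
Proof.
split; first by rewrite /std_emb -[cst m 1%g]/(1%g : G) gmon1 tofrac1.
by move=> p q; rewrite /std_emb cstM gmonM tofracM.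
Qed.

Lemma std_mon g : mon std_emb std_cluster g = tofrac (gmon g).
Proof.
have expE (k : G) z : tofrac (gmon (gexpz k z)) = (tofrac (gmon k) : std_field) ^ z.
  have X n : tofrac (gmon (k ^+ n)%g) = (tofrac (gmon k) : std_field) ^+ n.
    by elim: n => [|n IH]; rewrite ?gmon1 ?tofrac1 // expgS exprS gmonM tofracM IH.
  case: z => n; first exact: X.
  have k0 : tofrac (gmon (k ^+ n.+1)%g) != 0 :> std_field by rewrite tofrac_eq0 gmon_neq0.
  rewrite /gexpz NegzE -exprnN -X; apply: (mulfI k0).
  by rewrite divff // -tofracM -gmonM mulgV gmon1 tofrac1.
pose pr := \big[@monoid.mul G/1%g]_i gexpz (var P i) (expo i g).
have prE : g = (cst m g.1 * pr)%g.
  apply: gam_eq => [|l].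
    rewrite gam_coefM (big_morph (fun h : G => h.1) (id1 := 1%g) (op1 := @monoid.mul P)) //.
    by rewrite big1 ?mulg1 // => i _; rewrite coef_gexpz gexpz1g.
  rewrite expoM expo_cst add0r (big_morph (expo l) (id1 := 0) (op1 := +%R)) //.
  rewrite (bigD1 l) //= big1 ?addr0 => [|i il]; rewrite expo_gexpz expo_var ?eqxx ?mul1r //.
  by rewrite eq_sym (negPf il) mul0r.
rewrite {2}prE gmonM tofracM /mon; congr (_ * _).
rewrite (big_morph (fun h : G => tofrac (gmon h) : std_field) (id1 := 1) (op1 := *%R)).
- by apply: eq_bigr => i _; rewrite ffunE expE.
- by move=> a b; rewrite gmonM tofracM.
- by rewrite gmon1 tofrac1.
Qed.

Lemma std_free : alg_free std_emb std_cluster.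
Proof.
have evE f : ev std_emb std_cluster f = tofrac f.
  apply: (@groupring_ind _ (fun f => ev std_emb std_cluster f = tofrac f)).
  - by rewrite ev0 tofrac0.
  - by move=> u v uE vE; rewrite evB tofracB uE vE.
  - by move=> g _; rewrite ev_gmon std_mon.
by move=> f f'; rewrite !evE => /eqP; rewrite tofrac_eq => /eqP.
Qed.
End StandardSeed.

(** * Seeds are algebraically independent over the semifield *)

Section SeedsAreFree.
Variables (m : nat) (P : semifieldType) (F : fieldType) (iota : {rmorphism ratfield P -> F}).
Local Notation G := (gam m P).

Lemma sfemb_mult : multiplicative_map (sfemb iota).
Proof.
split; first by rewrite /sfemb -[(<< 1 *g 1%g >> : groupring P)]/(1 : groupring P) tofrac1 rmorph1.
move=> p q; rewrite /sfemb -rmorphM -tofracM.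
by rewrite -[_ * _ in RHS]/(gr_mul _ _) gr_mulUU mulr1.
Qed.

Definition shift (N : nat) (g : G) : mpoly.multinom m :=
  mpoly.Multinom [tuple absz (expo i g + N%:Z) | i < m].

Lemma shiftE N g i : mpoly.fun_of_multinom (shift N g) i = absz (expo i g + N%:Z).
Proof. by rewrite mpoly.mnmE. Qed.

Local Notation MP := (mpoly.mpoly m (ratfield P)).
Let gr (p : P) : groupring P := << 1 *g p >>.

(** Clearing denominators by [N]-th powers of the variables turns a Laurent
    polynomial into a polynomial, for which independence is assumed. *)
Definition clear_mpoly (N : nat) : zring G -> MP :=
  ext (fun g => (tofrac (gr g.1) : ratfield P) *: mpoly.mpolyX (ratfield P) (shift N g)).

(** The coefficient of the cleared polynomial at [nu], before passing to
    fractions. *)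
Definition slice (N : nat) (nu : mpoly.multinom m) : zring G -> groupring P :=
  ext (fun g => if shift N g == nu then gr g.1 else 0).

Lemma clear_coef N nu f : mpoly.mcoeff nu (clear_mpoly N f) = tofrac (slice N nu f).
Proof.
apply: (@groupring_ind _ (fun f => mpoly.mcoeff nu (clear_mpoly N f) = tofrac (slice N nu f))).
- by rewrite /clear_mpoly /slice !ext0 mpoly.mcoeff0 tofrac0.
- move=> u v uE vE; rewrite /clear_mpoly /slice !extB mpoly.mcoeffB tofracB.
  by congr (_ - _); [exact: uE | exact: vE].
move=> g _; rewrite /clear_mpoly /slice !ext_gmon mpoly.mcoeffZ mpoly.mcoeffX.
by case: (_ == _); rewrite ?mulr1 ?mulr0 ?tofrac0.
Qed.

Lemma slice_coef (N : nat) g f :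
  (forall h, h \in zsupp f -> forall i, - N%:Z <= expo i h) ->
  (forall i, - N%:Z <= expo i g) ->
  mcoeff g.1 (slice N (shift N g) f) = zcoef g f.
Proof.
move=> fN gN; apply: (@groupring_ind _ (fun f => mcoeff g.1 (slice N (shift N g) f) = zcoef g f)).
- by rewrite /slice ext0 mcoeff0 zcoef0.
- move=> u v uE vE; rewrite /slice extB mcoeffB zcoefB.
  by congr (_ - _); [exact: uE | exact: vE].
move=> h hf; rewrite /slice ext_gmon gmon_coef.
have [->|gh] := eqVneq h g; first by rewrite eqxx mcoeffU eqxx.
case: eqP => [sh|_]; last by rewrite mcoeff0.
rewrite mcoeffU; case: eqP => // h1; case/eqP: gh; apply: gam_eq => // i.
have := congr1 (fun nu => mpoly.fun_of_multinom nu i) sh; rewrite !shiftE.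
by have := fN h hf i; have := gN i; lia.
Qed.

Lemma clear_eval (x : {ffun 'I_m -> F}) (N : nat) f : (forall i, x i != 0) ->
  (forall h, h \in zsupp f -> forall i, - N%:Z <= expo i h) ->
  mpoly.mmap iota x (clear_mpoly N f) = ev (sfemb iota) x f * \prod_i x i ^+ N.
Proof.
move=> x0 fN; apply: (@groupring_ind _ (fun f =>
  mpoly.mmap iota x (clear_mpoly N f) = ev (sfemb iota) x f * \prod_i x i ^+ N)).
- by rewrite /clear_mpoly ext0 mpoly.mmap0 ev0 mul0r.
- move=> u v uE vE; rewrite /clear_mpoly extB mpoly.mmapB evB mulrBl.
  by congr (_ - _); [exact: uE | exact: vE].
move=> g /fN gN; rewrite /clear_mpoly ext_gmon mpoly.mmapZ mpoly.mmapX ev_gmon /mon -mulrA.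
congr (_ * _); rewrite /mpoly.mmap1 -big_split; apply: eq_bigr => i _ /=.
rewrite shiftE !exprnP -expfzDr //; congr (_ ^ _).
have absE (z : int) : - N%:Z <= z -> Posz (absz (z + N%:Z)) = z + N%:Z by lia.
exact: absE (gN i).
Qed.

(** Algebraic independence for polynomials over the fraction field implies it for
    Laurent polynomials over the group ring: clear the denominators. *)
Lemma seed_free (x : {ffun 'I_m -> F}) : free_generating iota x -> alg_free (sfemb iota) x.
Proof.
move=> [xinj _].
have x0 i : x i != 0.
  apply/negP => /eqP xi0; have E : mpoly.mpolyX (ratfield P) (mpoly.mnm1 i) = 0 :> MP.
    by apply: (xinj); rewrite mpoly.mmapX mpoly.mmap1U xi0 mpoly.mmap0.
  have := congr1 (mpoly.mcoeff (mpoly.mnm1 i)) E.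
  by rewrite mpoly.mcoeffX eqxx mpoly.mcoeff0 => /eqP; rewrite oner_eq0.
suff ker f : ev (sfemb iota) x f = 0 -> f = 0.
  by move=> f f' ff'; apply/subr0_eq/ker; rewrite evB ff' subrr.
move=> f0.
have [N fN] : exists N : nat, forall h, h \in zsupp f -> forall i, - N%:Z <= expo i h.
  have /(_ _)/boolp.cid H i : exists N : nat, forall h, h \in zsupp f -> - N%:Z <= expo i h.
    by have [N Nf] := supp_bound (expo i) f; exists N => h /Nf /andP [/ltW].
  exists (\max_i sval (H i)) => h hf i.
  have := svalP (H i) h hf; have : (sval (H i) <= \max_i sval (H i))%N by exact: leq_bigmax.
  lia.
have C0 : clear_mpoly N f = 0.
  by apply: (xinj); rewrite clear_eval // f0 mul0r mpoly.mmap0.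
apply: groupringP => g; rewrite zcoef0.
have [gf|gf] := boolP (g \in zsupp f); last exact: zcoef_outdom.
rewrite -(slice_coef fN (fN g gf)).
have := clear_coef N (shift N g) f; rewrite C0 mpoly.mcoeff0 => /esym/eqP.
by rewrite tofrac_eq0 => /eqP ->; rewrite mcoeff0.
Qed.
End SeedsAreFree.

(** * The exchange graph *)

Local Open Scope quotient_scope.

Section Transport.
Variables (m : nat) (P P' : semifieldType) (F F' : fieldType).
Variables (emb : P -> F) (emb' : P' -> F').
Hypotheses (embP : multiplicative_map emb) (emb'P : multiplicative_map emb').
Implicit Types (s : preseed m P F) (t : preseed m P' F').
Local Notation P0 := (tcover m (P * P')%type).

(** Lift the period to the tropical cover of the product of the two semifields,
    then project to the other factor. *)
Lemma period_transport s t ks sg : good emb s -> good emb' t -> exmat t = exmat s ->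
  muts emb ks s = renumber sg s -> muts emb' ks t = renumber sg t.
Proof.
move=> gs gt BE.
pose y0 : {ffun 'I_m -> P * P'} := [ffun i => (coeffs s i, coeffs t i)].
pose c : preseed m P0 (std_field m P0) :=
  Preseed (std_cluster m _) (tcover_coeffs (Q := (P * P')%type) y0) (exmat s).
have skB : (exmat s)^T = - exmat s by case: gs.
have cP := std_embP m P0.
have gc : good (@std_emb m P0) c by split => //; exact: std_free.
have indep : coef_indep (@std_emb m P0) c by exact: tcover_indep.
have st : paired (fun p : P0 => p.1.1) c s.
  by split=> //; apply/ffunP => i; rewrite !ffunE.
have tt : paired (fun p : P0 => p.1.2) c t.
  by split=> //; apply/ffunP => i; rewrite !ffunE.
move=> E; have Ec : muts (@std_emb m P0) ks c = renumber sg c.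
  by apply: (lift_period (phi := fun p : P0 => p.1.1) _ _ cP embP gc gs st indep E).
by apply: (descend_period (phi := fun p : P0 => p.1.2) _ _ cP emb'P gc gt tt Ec).
Qed.

(** Going back along [ks] and then along [ls] is a period of the seed reached
    by [ks]. *)
Lemma coincidence_transport s t ks ls sg : good emb s -> good emb' t -> exmat t = exmat s ->
  muts emb ls s = renumber sg (muts emb ks s) ->
  muts emb' ls t = renumber sg (muts emb' ks t).
Proof.
move=> gs gt BE E.
have BEks : exmat (muts emb' ks t) = exmat (muts emb ks s).
  by elim: ks (s) (t) BE {E gs gt} => //= k ks IH s' t' BE'; apply: IH; rewrite /= BE'.
have gs' := good_muts embP ks gs; have gt' := good_muts emb'P ks gt.
have := period_transport (ks := rev ks ++ ls) (sg := sg) gs' gt' BEks.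
by rewrite !muts_cat !muts_rev //; apply.
Qed.
End Transport.

Section Words.
Variables (m : nat) (P : semifieldType) (F : fieldType).
Variable iota : {rmorphism ratfield P -> F}.
Local Notation emb := (sfemb iota).
Implicit Types (s : preseed m P F).

Lemma unlabelP s s' : unlabel s = unlabel s' <-> exists sg, s' = renumber sg s.
Proof.
split=> [/eqmodP /existsP [sg /eqP ->]|[sg ->]]; first by exists sg.
by apply/eqmodP/existsP; exists sg.
Qed.

Lemma mutations_muts ks s : foldl (fun s k => mutation iota k s) s ks = muts emb ks s.
Proof. by elim: ks s => //= k ks IH s; rewrite mutationE IH. Qed.

Lemma is_seed_good s : is_seed iota s -> good emb s.
Proof. by move=> [/seed_free]. Qed.

Variable s0 : preseed m P F.
Local Notation V := (vertex (exchange_graph iota s0)).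

Definition word_vertex ks : V := exist _ (unlabel (muts emb ks s0))
  (ex_intro _ _ (conj (ex_intro _ ks (esym (mutations_muts ks s0))) erefl)).

Lemma vertex_word (u : V) : exists ks, u = word_vertex ks.
Proof.
case: u => u ur; have [s [[ks sE] uE]] := ur; exists ks.
by apply: boolp.eq_exist; rewrite uE sE mutations_muts.
Qed.

(** Mutating a renumbered representative at [k] is mutating the original
    one at [sg k]. *)
Lemma adj_word ks (v : V) : adj (word_vertex ks) v <->
  exists k, v = word_vertex (rcons ks k).
Proof.
split=> [[s [k [/= /unlabelP [sg ->] vE]]]|[k ->]].
  exists (sg k); case: v vE => v vr /= vE; apply: boolp.eq_exist.
  rewrite vE mutationE mut_renumber -cats1 muts_cat; apply/esym/unlabelP.
  by exists sg.
exists (muts emb ks s0), k; split=> //=.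
by rewrite mutationE -cats1 muts_cat.
Qed.
End Words.

Section GraphIso.
Variables (G H : graph) (W : Type) (g : W -> vertex G) (h : W -> vertex H).
Hypotheses (gsurj : forall u, exists w, u = g w) (hsurj : forall u, exists w, u = h w).
Hypothesis gh : forall w w', g w = g w' <-> h w = h w'.
Hypothesis adj_gh : forall w w', adj (g w) (g w') <-> adj (h w) (h w').

(** Two graphs with vertices named by the same words are isomorphic when the names
    are identified alike and adjacency depends alike on them. *)
Lemma graph_iso_param : graph_iso G H.
Proof.
pose wg u := sval (boolp.cid (gsurj u)); pose wh u := sval (boolp.cid (hsurj u)).
have wgE u : g (wg u) = u by rewrite /wg; case: boolp.cid.
have whE u : h (wh u) = u by rewrite /wh; case: boolp.cid.
exists (h \o wg) => [|u v]; last by rewrite -{1}(wgE u) -{1}(wgE v); exact: adj_gh.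
exists (g \o wh) => u /=.
  by rewrite -[RHS]wgE; apply/gh; rewrite whE.
by rewrite -[RHS]whE; apply/gh; rewrite wgE.
Qed.
End GraphIso.

Theorem corollary5p5 (m : nat) (B : 'M[int]_m)
    (P : semifieldType) (F : fieldType)
    (iota : {rmorphism ratfield P -> F})
    (x : {ffun 'I_m -> F}) (y : {ffun 'I_m -> P})
    (P' : semifieldType) (F' : fieldType)
    (iota' : {rmorphism ratfield P' -> F'})
    (x' : {ffun 'I_m -> F'}) (y' : {ffun 'I_m -> P'}) :
  is_seed iota (Preseed x y B) ->
  is_seed iota' (Preseed x' y' B) ->
  graph_iso (exchange_graph iota (Preseed x y B))
            (exchange_graph iota' (Preseed x' y' B)).
Proof.
move=> /is_seed_good gs /is_seed_good gt.
have eP := sfemb_mult iota; have eP' := sfemb_mult iota'.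
have eqv ks ls : word_vertex iota (Preseed x y B) ks = word_vertex iota (Preseed x y B) ls <->
    word_vertex iota' (Preseed x' y' B) ks = word_vertex iota' (Preseed x' y' B) ls.
  split=> /(congr1 sval) /= /unlabelP [sg E]; apply: boolp.eq_exist; apply/unlabelP; exists sg.
    exact: (coincidence_transport eP eP' gs gt erefl E).
  exact: (coincidence_transport eP' eP gt gs erefl E).
apply: (graph_iso_param (@vertex_word _ _ _ iota _) (@vertex_word _ _ _ iota' _) eqv) => ks ls.
by split=> /adj_word [k /eqv E]; apply/adj_word; exists k.
Qed.
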